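(* Let $n,K\ge 1$ be integers, let $\mathbf F^*\in\mathbb R^{K\times n}$ be deterministic, let $\boldsymbol\xi=[\boldsymbol\xi_1,\ldots,\boldsymbol\xi_n]$ be a $K\times n$ random matrix and let $\mathbf Y=\mathbf F^*+\boldsymbol\xi$. Let $\mathcal F$ be a measurable set of real $K\times n$ matrices, $\pi_0$ a probability measure on $\mathcal F$, $\tau>0$, and let $\widehat{\mathbf F}^{\rm EWA}=\int_{\mathcal F}\mathbf F\,\pi_n(d\mathbf F)$ be the exponentially weighted aggregate with prior $\pi_0$ and temperature $\tau$. Suppose that, for some finite positive constants $B_\xi$ and $L$, $$\max_{i\in[n]}\mathbf P\big(\|\boldsymbol\xi_i\|_2^2>KB_\xi^2\big)=0,\qquad \sup_{\mathbf F,\mathbf F'\in\mathcal F}\ \max_{i\in[n]}\|\mathbf F_i-\mathbf F'_i\|_2^2\le KL^2,$$ and that the distribution of $\boldsymbol\xi$ is symmetric in the sense that for any sign vector $\boldsymbol s\in\{\pm1\}^n$ the matrix $[s_1\boldsymbol\xi_1,\ldots,s_n\boldsymbol\xi_n]$ has the same distribution as $\boldsymbol\xi$. Then, for every $\tau\ge \frac1n (KB_\xi)\max(2L,3B_\xi)$, $$\mathbf E[\ell_n(\widehat{\mathbf F}^{\rm EWA},\mathbf F^* )]\le \inf_p\bigg\{\int_{\mathcal F}\ell_n(\mathbf F,\mathbf F^* )\,p(d\mathbf F)+2\tau D_{\rm KL}(p\,\|\,\pi_0)\bigg\},$$ where the infimum is over all probability measures $p$ on $\mathcal F$. Furthermore,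 for every $\tau\ge\frac1n(KB_\xi)\max(2L,6B_\xi)$, with $\widehat{\mathbf F}=\widehat{\mathbf F}^{\rm EWA}$, $$\mathbf E[\ell_n(\widehat{\mathbf F},\mathbf F^* )]\le \inf_p\bigg\{\int_{\mathcal F}\ell_n(\mathbf F,\mathbf F^* )\,p(d\mathbf F)+2\tau D_{\rm KL}(p\,\|\,\pi_0)\bigg\}-\frac12\,\mathbf E\bigg[\int_{\mathcal F}\ell_n(\widehat{\mathbf F},\mathbf F)\,\pi_n(d\mathbf F)\bigg].$$
   Context: Notation: $[n]=\{1,\ldots,n\}$; $\mathbf F_i\in\mathbb R^K$ denotes the $i$-th column of a $K\times n$ matrix $\mathbf F$; $\|\cdot\|_2$ is the Euclidean norm and $\|\cdot\|_F$ the Frobenius norm. The columns of $\boldsymbol\xi$ are not assumed independent. The empirical loss is $\ell_n(\mathbf F,\mathbf G)=\frac1n\|\mathbf F-\mathbf G\|_F^2=\frac1n\sum_{i\in[n]}\|\mathbf F_i-\mathbf G_i\|_2^2$. The tempered posterior $\pi_n$ (a random probability measure on $\mathcal F$, depending on $\mathbf Y$) is defined by $$\pi_n(d\mathbf F)\propto \exp\Big\{-\frac1{2\tau}\ell_n(\mathbf F,\mathbf Y)\Big\}\,\pi_0(d\mathbf F),$$ and $\widehat{\mathbf F}^{\rm EWA}=\int_{\mathcal F}\mathbf F\,\pi_n(d\mathbf F)$. $D_{\rm KL}(p\,\|\,\pi_0)$ is the Kullback–Leibler divergence, equal to $\int\log\frac{dp}{d\pi_0}\,dp$ if $p\ll\pi_0$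 and $+\infty$ otherwise. *)

(* Defs.v *)
From HB Require Import structures.
From mathcomp Require Import all_boot all_order all_algebra.
From mathcomp Require Import all_classical all_reals all_analysis.
From mathcomp Require Import measurable_realfun.

Set Implicit Arguments.
Unset Strict Implicit.
Unset Printing Implicit Defensive.

Import Order.TTheory GRing.Theory Num.Theory.
Import numFieldNormedType.Exports.

Local Open Scope classical_set_scope.
Local Open Scope ring_scope.

(* Real matrices carry the Borel sigma-algebra of their usual topology. *)
Section matrix_borel.
Context (R : realType) (m n : nat).

HB.instance Definition _ := @isMeasurable.Build
  (sigma_display (@open 'M[R]_(m, n))) 'M[R]_(m, n)
  <<s @open 'M[R]_(m, n) >>
  (@sigma_algebra0 _ setT _) (@sigma_algebraC _ _)
  (@sigma_algebra_bigcup _ setT _).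

Lemma measurable_mx_coord (i : 'I_m) (j : 'I_n) :
  measurable_fun [set: 'M[R]_(m, n)] (fun F : 'M[R]_(m, n) => F i j).
Proof.
apply: (measurability _ (RGenOpens.measurableE R)) => _ [_ [a [b ->]] <-].
rewrite setTI; apply: sub_sigma_algebra.
by apply: open_comp => [F _|]; [exact: coord_continuous|exact: interval_open].
Qed.

End matrix_borel.

Section norms.
Context (R : realType).

Definition enorm (K : nat) (v : 'cV[R]_K) : R :=
  Num.sqrt (\sum_(k < K) v k 0 ^+ 2).

Definition frobenius (K n : nat) (F : 'M[R]_(K, n)) : R :=
  Num.sqrt (\sum_(k < K) \sum_(i < n) F k i ^+ 2).

Definition ell (K n : nat) (F G : 'M[R]_(K, n)) : R :=
  n%:R^-1 * frobenius (F - G) ^+ 2.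

Lemma ellE (K n : nat) (F G : 'M[R]_(K, n)) :
  ell F G = n%:R^-1 * \sum_(i < n) enorm (col i F - col i G) ^+ 2.
Proof.
rewrite /ell /frobenius sqr_sqrtr; last first.
  by apply: sumr_ge0 => k _; apply: sumr_ge0 => i _; exact: sqr_ge0.
rewrite exchange_big/=; congr (_ * _); apply: eq_bigr => i _.
rewrite sqr_sqrtr; last by apply: sumr_ge0 => k _; exact: sqr_ge0.
by apply: eq_bigr => k _; rewrite !mxE.
Qed.

Lemma measurable_ell (K n : nat) (G : 'M[R]_(K, n)) :
  measurable_fun [set: 'M[R]_(K, n)] (fun F => ell F G).
Proof.
rewrite (_ : (fun F => _) = fun F : 'M[R]_(K, n) =>
    n%:R^-1 * \sum_(k < K) \sum_(i < n) (F k i - G k i) ^+ 2).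
  apply: measurable_funM => //; apply: measurable_sum => k.
  apply: measurable_sum => i; apply: measurable_funX.
  by apply: measurable_funB => //; exact: measurable_mx_coord.
apply/funext => F; rewrite /ell /frobenius sqr_sqrtr; last first.
  by apply: sumr_ge0 => k _; apply: sumr_ge0 => i _; exact: sqr_ge0.
by congr (_ * _); apply: eq_bigr => k _; apply: eq_bigr => i _; rewrite !mxE.
Qed.

End norms.

Section aggregate.
Local Open Scope ereal_scope.
Context (R : realType) (K n : nat).
Variables (prior : probability 'M[R]_(K, n) R) (tau : R) (Y : 'M[R]_(K, n)).

Definition gibbs_weight (F : 'M[R]_(K, n)) : R :=
  expR (- (2 * tau)^-1 * ell F Y).

Lemma measurable_gibbs_weight : measurable_fun setT gibbs_weight.
Proof.
apply: measurableT_comp => //; apply: measurable_funM => //.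
exact: measurable_ell.
Qed.

Definition gibbs_measure (A : set 'M[R]_(K, n)) : \bar R :=
  \int[prior]_(F in A) (gibbs_weight F)%:E.

Let gibbs0 : gibbs_measure set0 = 0.
Proof. exact: integral_set0. Qed.

Let gibbs_ge0 A : 0 <= gibbs_measure A.
Proof. by apply: integral_ge0 => F _; rewrite lee_fin expR_ge0. Qed.

Let gibbs_sigma_additive : semi_sigma_additive gibbs_measure.
Proof.
apply: semi_sigma_additive_nng_induced => [|F]; last by rewrite lee_fin expR_ge0.
by apply/measurable_EFinP; exact: measurable_gibbs_weight.
Qed.

HB.instance Definition _ :=
  isMeasure.Build _ _ _ gibbs_measure gibbs0 gibbs_ge0 gibbs_sigma_additive.

(* The second argument of [mnormalize] is a default value for a measure of total
   mass 0 or +oo; it is irrelevant when tau > 0, see [posteriorE]. *)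
Definition posterior : probability 'M[R]_(K, n) R :=
  mnormalize gibbs_measure prior.

Lemma gibbs_measureT : (0 < tau)%R -> 0 < gibbs_measure setT <= 1.
Proof.
move=> tau0.
have ell0 F : (0 <= ell F Y)%R by rewrite mulr_ge0 ?invr_ge0 ?ler0n ?sqr_ge0.
have mw : measurable_fun setT (EFin \o gibbs_weight).
  by apply/measurable_EFinP; exact: measurable_gibbs_weight.
apply/andP; split; last first.
  rewrite -(probability_setT prior) -[leRHS]mul1e -integral_cst//.
  apply: ge0_le_integral => // [F _|F _]; first by rewrite lee_fin expR_ge0.
  rewrite lee_fin -expR0 ler_expR mulNr oppr_le0 mulr_ge0//.
  by rewrite invr_ge0 mulr_ge0// ltW.
rewrite lt_neqAle gibbs_ge0 andbT eq_sym; apply/negP => /eqP g0.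
have [|N [mN N0 TN]] := (ae_eq_integral_abs prior measurableT mw).1.
  rewrite -[RHS]g0; apply: eq_integral => F _.
  by rewrite gee0_abs// lee_fin expR_ge0.
have := probability_setT prior; rewrite (_ : setT = N).
  by rewrite N0 => /esym/eqP; rewrite onee_eq0.
apply/esym; rewrite -subTset => F _; apply: TN => /= /(_ I)[] /eqP.
by rewrite gt_eqF// expR_gt0.
Qed.

Lemma posteriorE (A : set 'M[R]_(K, n)) : (0 < tau)%R ->
  posterior A = gibbs_measure A * (fine (gibbs_measure setT))^-1%:E.
Proof.
move=> /gibbs_measureT/andP[g0 g1]; rewrite /posterior/= /mnormalize.
by rewrite gt_eqF//= lt_eqF// (le_lt_trans g1)// ltry.
Qed.

(* The matrix-valued mean is taken entrywise. The real-valued integral used here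
   is 0 for entries whose integral is infinite, which cannot happen when D is
   bounded. *)
Definition EWA (D : set 'M[R]_(K, n)) : 'M[R]_(K, n) :=
  \matrix_(k, i) (\int[posterior]_(F in D) F k i)%R.

End aggregate.

Section divergence.
Local Open Scope ereal_scope.
Local Open Scope charge_scope.
Context d (T : measurableType d) (R : realType).

(* Where the derivative is <= 0 the extended logarithm [lne] is -oo; this set is
   p-null and does not affect the integral. *)
Definition KL (p q : probability T R) : \bar R :=
  if `[< p `<< q >] then
    \int[p]_x lne (('d (charge_of_finite_measure p) '/d q) x)
  else +oo.

End divergence.

(* A probability measure on a measurable set D of matrices is represented by a
   probability measure on the whole space that gives mass 1 to D. *)
Definition probability_on d (T : measurableType d) (R : realType) (D : set T) :
    set (probability T R) :=
  [set p | p D = 1%E].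

Definition same_law d d' (T : measurableType d) (T' : measurableType d')
    (R : realType) (P : probability T R) (X X' : T -> T') : Prop :=
  forall A, measurable A -> P (X @^-1` A) = P (X' @^-1` A).

Definition scale_cols (R : realType) (K n : nat) (s : 'I_n -> R)
    (F : 'M[R]_(K, n)) : 'M[R]_(K, n) :=
  \matrix_(k, i) (s i * F k i).

Definition oracle_bound (R : realType) (K n : nat) (D : set 'M[R]_(K, n))
    (prior : probability 'M[R]_(K, n) R) (tau : R) (Fstar : 'M[R]_(K, n)) :
    \bar R :=
  ereal_inf [set (\int[p]_(F in D) (ell F Fstar)%:E
                  + (2 * tau)%:E * KL p prior)%E
            | p in @probability_on _ 'M[R]_(K, n) R D].

(* Main.v *)
(* Write V(Y) for the posterior mean of ell(Fhat, F).  The Gibbs variational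
   principle bounds ell(Fhat, Y) + V(Y) by the average of ell(F, Y) under p plus
   2 tau KL(p || prior), for every p; hence, with M_p the mean of p,
     E ell(Fhat, F* ) + E V <= oracle(p) + (2/n) E <xi, Fhat - M_p>,
   and E <xi, M_p> = 0 by symmetry.
   The correlation of the noise with Fhat is controlled column by column, without
   differentiation: flipping the sign of xi_i turns the posterior pi into an
   exponential tilt pi' of it, and symmetry gives
     E <xi_i, Fhat_i> = (1/2) E (pi(X) - pi'(X)),  where X(F) = <xi_i, F_i>.
   Since X oscillates by at most K B L <= tau n / 2, a two-point symmetrization
   bounds pi(X) - pi'(X) by (3 / (2 tau n)) (Var_pi X + Var_pi' X).  Cauchy-Schwarz
   and a second use of symmetry yield
     (2/n) E <xi, Fhat> <= (3 K B^2 / (tau n)) E V,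
   whose coefficient is at most 1, resp. 1/2, under the two conditions on tau. *)
Require Import Defs.
From mathcomp Require Import all_boot all_order all_algebra.
From mathcomp Require Import all_classical all_reals all_analysis.
From mathcomp Require Import measurable_realfun ring lra.

Set Implicit Arguments.
Unset Strict Implicit.
Unset Printing Implicit Defensive.

Import Order.TTheory GRing.Theory Num.Theory.
Import numFieldNormedType.Exports.

Local Open Scope classical_set_scope.
Local Open Scope ring_scope.

(** * Bounded measurable functions and their means under a probability measure *)

Section bounded_measurable.
Context d (T : measurableType d) (R : realType) (D : set T).
Implicit Types f g : T -> R.

(** This class is closed under ring operations and lies in L1 of every probability measure, so
    linearity of the integral reduces to closure properties. Both conditions are relative to [D],
    since the entries of matrices and of noise are bounded only on suitable sets. *)
Definition bmfun f : Prop :=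
  measurable_fun D f /\ exists M, forall x, D x -> `|f x| <= M.

Lemma bmfun_cst (c : R) : bmfun (fun=> c).
Proof. by split; [exact: measurable_cst|exists `|c|]. Qed.

Lemma bmfunD f g : bmfun f -> bmfun g -> bmfun (fun x => f x + g x).
Proof.
move=> [mf [a fa]] [mg [b gb]]; split; first exact: measurable_funD.
exists (a + b) => x Dx; rewrite (le_trans (ler_normD _ _))//.
by rewrite lerD// ?fa ?gb.
Qed.

Lemma bmfunM f g : bmfun f -> bmfun g -> bmfun (fun x => f x * g x).
Proof.
move=> [mf [a fa]] [mg [b gb]]; split; first exact: measurable_funM.
by exists (a * b) => x Dx; rewrite normrM ler_pM// ?fa ?gb.
Qed.

Lemma bmfunZ c f : bmfun f -> bmfun (fun x => c * f x).
Proof. by move=> bf; exact: bmfunM (bmfun_cst c) bf. Qed.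

Lemma bmfunN f : bmfun f -> bmfun (fun x => - f x).
Proof.
move=> bf; rewrite (_ : (fun _ => _) = fun x => -1 * f x); first exact: bmfunZ.
by apply/funext => x; rewrite mulN1r.
Qed.

Lemma bmfunB f g : bmfun f -> bmfun g -> bmfun (fun x => f x - g x).
Proof. by move=> bf bg; exact: bmfunD bf (bmfunN bg). Qed.

Lemma bmfunX f m : bmfun f -> bmfun (fun x => f x ^+ m).
Proof.
move=> bf; elim: m => [|m IH]; first exact: bmfun_cst.
rewrite (_ : (fun _ => _) = fun x => f x * f x ^+ m); first exact: bmfunM.
by apply/funext => x; rewrite exprS.
Qed.

Lemma bmfun_sum (I : Type) (s : seq I) (F : I -> T -> R) :
  (forall i, bmfun (F i)) -> bmfun (fun x => \sum_(i <- s) F i x).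
Proof.
move=> bF; elim: s => [|i s IH].
  rewrite (_ : (fun _ => _) = fun=> 0); first exact: bmfun_cst.
  by apply/funext => x; rewrite big_nil.
rewrite (_ : (fun _ => _) = fun x => F i x + \sum_(j <- s) F j x).
  exact: bmfunD.
by apply/funext => x; rewrite big_cons.
Qed.

Variables (mD : measurable D).

Lemma bmfun_integrable (mu : probability T R) f :
  bmfun f -> mu.-integrable D (EFin \o f).
Proof.
move=> [mf [M fM]]; apply: measurable_bounded_integrable => //.
  by rewrite (le_lt_trans (probability_le1 mu mD))// ltry.
by exists M; split; [exact: num_real|move=> y My x /fM h; exact: le_trans h (ltW My)].
Qed.

Lemma bmfun_integralE (mu : probability T R) f : bmfun f ->
  (\int[mu]_(x in D) (f x)%:E)%E = (\int[mu]_(x in D) f x)%:E.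
Proof.
move=> bf; rewrite /Rintegral fineK//.
exact: integrable_fin_num (bmfun_integrable mu bf).
Qed.

Variables (mu : probability T R) (muD : mu D = 1%E).
Local Notation mean f := (\int[mu]_(x in D) f x).

Lemma mean_cst c : mean (fun=> c) = c.
Proof. by rewrite Rintegral_cst// [X in fine X]muD mulr1. Qed.

Lemma meanZ c f : bmfun f -> mean (fun x => c * f x) = c * mean f.
Proof. by move=> bf; rewrite RintegralZl//; exact: bmfun_integrable. Qed.

Lemma meanD f g : bmfun f -> bmfun g ->
  mean (fun x => f x + g x) = mean f + mean g.
Proof. by move=> bf bg; rewrite RintegralD//; exact: bmfun_integrable. Qed.

Lemma meanB f g : bmfun f -> bmfun g ->
  mean (fun x => f x - g x) = mean f - mean g.
Proof. by move=> bf bg; rewrite RintegralB//; exact: bmfun_integrable. Qed.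

Lemma mean_sum (I : Type) (s : seq I) (F : I -> T -> R) :
  (forall i, bmfun (F i)) ->
  mean (fun x => \sum_(i <- s) F i x) = \sum_(i <- s) mean (F i).
Proof.
move=> bF; elim: s => [|i s IH].
  rewrite big_nil -[RHS](mean_cst 0); apply: eq_Rintegral => x _.
  by rewrite big_nil.
rewrite big_cons -IH -meanD//; last exact: bmfun_sum.
by apply: eq_Rintegral => x _; rewrite big_cons.
Qed.

Lemma mean_le f g : bmfun f -> bmfun g -> (forall x, D x -> f x <= g x) ->
  mean f <= mean g.
Proof. by move=> bf bg; apply: le_Rintegral => //; exact: bmfun_integrable. Qed.

Lemma mean_norm_le f M : bmfun f -> (forall x, D x -> `|f x| <= M) ->
  `|mean f| <= M.
Proof.
move=> bf fM; have bM c := bmfun_cst c.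
rewrite ler_norml -{1}(mean_cst (- M)) -{2}(mean_cst M).
by apply/andP; split; apply: mean_le => // x /fM; rewrite ler_norml => /andP[].
Qed.

Lemma mean_sqB f c : bmfun f ->
  mean (fun x => (f x - c) ^+ 2) = mean (fun x => f x ^+ 2) - 2 * c * mean f + c ^+ 2.
Proof.
move=> bf; rewrite -[in RHS](mean_cst (c ^+ 2)) -meanZ// -meanB//; last 2 first.
- exact: bmfunX.
- exact: bmfunZ.
rewrite -meanD//; last 2 first.
- by apply: bmfunB; [exact: bmfunX|exact: bmfunZ].
- exact: bmfun_cst.
by apply: eq_Rintegral => x _; ring.
Qed.

Lemma mean_variance f : bmfun f ->
  mean (fun x => (f x - mean f) ^+ 2) = mean (fun x => f x ^+ 2) - mean f ^+ 2.
Proof. by move=> bf; rewrite mean_sqB//; ring. Qed.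

(** Six terms are what the two-point inequality for tilted densities expands into: the moments of
    order 0, 1 and 2 of [X] under each of two densities. *)
Lemma mean_lin6 (c0 c1 c2 c3 c4 c5 : R) (f0 f1 f2 f3 f4 f5 : T -> R) :
  bmfun f0 -> bmfun f1 -> bmfun f2 -> bmfun f3 -> bmfun f4 -> bmfun f5 ->
  mean (fun x => c0 * f0 x + c1 * f1 x + c2 * f2 x + c3 * f3 x + c4 * f4 x
                 + c5 * f5 x) =
  c0 * mean f0 + c1 * mean f1 + c2 * mean f2 + c3 * mean f3 + c4 * mean f4
  + c5 * mean f5.
Proof.
move=> b0 b1 b2 b3 b4 b5.
rewrite -!meanZ// -!meanD//; repeat (apply: bmfunD); exact: bmfunZ.
Qed.

End bounded_measurable.

(** * Change of a mean under an exponential tilt *)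

Section tilting.
Context (R : realType).

(** From e^u <= 1/(1 - u) the left side is at most u(2 - u)/(1 - u), and (2 - u)/(1 - u) <= 3 means
    u <= 1/2. This is the source of the constant 3 and of the threshold 1/2 on the oscillation. *)
Lemma expR_sub_expRN_le (u : R) : 0 <= u <= 2^-1 -> expR u - expR (- u) <= 3 * u.
Proof.
move=> /andP[u0 u1]; have := expR_ge1Dx (- u).
have e0 := expR_gt0 u; rewrite expRN => h.
have : (1 - u) * expR u <= 1 by rewrite -ler_pdivlMr// div1r.
have := expR_ge1Dx u; nra.
Qed.

(** Both sides are even in [u], so the one-sided bound at |t u| covers both signs. *)
Lemma mul_expR_sub_le (t u : R) : 0 <= t -> `|t * u| <= 2^-1 ->
  u * (expR (t * u) - expR (- (t * u))) <= 3 * t * u ^+ 2.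
Proof.
move=> t0; have [u0|u0] := leP 0 u.
  rewrite ger0_norm ?mulr_ge0// => tu.
  have := @expR_sub_expRN_le (t * u); rewrite mulr_ge0//= => /(_ tu); nra.
rewrite ler0_norm => [tu|]; last by rewrite mulr_ge0_le0// ltW.
have := @expR_sub_expRN_le (- (t * u)).
rewrite tu oppr_ge0 mulr_ge0_le0 ?(ltW u0)// opprK => /(_ isT); nra.
Qed.

(* Integrate the pointwise inequality twice.  With u = t (X x - X y) and
   G = sqrt (p x * p y * q x * q y), the tilting hypothesis gives
   p x * q y = G e^u and q x * p y = G e^-u, while 2 G <= p x p y + q x q y
   by AM-GM. *)
Lemma tilted_mean_diff d (T : measurableType d) (mu : probability T R)
    (D : set T) (mD : measurable D) (muD : mu D = 1%E)
    (X p q : T -> R) (c t : R) :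
  bmfun D X -> bmfun D p -> bmfun D q ->
  (forall x, D x -> 0 <= q x) -> 0 <= c -> 0 <= t ->
  (forall x, D x -> p x = c * expR (2 * t * X x) * q x) ->
  (forall x y, D x -> D y -> `|t * (X x - X y)| <= 2^-1) ->
  \int[mu]_(x in D) p x = 1 -> \int[mu]_(x in D) q x = 1 ->
  \int[mu]_(x in D) (X x * p x) - \int[mu]_(x in D) (X x * q x) <=
  3 / 2 * t *
    ((\int[mu]_(x in D) (X x ^+ 2 * p x) -
      (\int[mu]_(x in D) (X x * p x)) ^+ 2) +
     (\int[mu]_(x in D) (X x ^+ 2 * q x) -
      (\int[mu]_(x in D) (X x * q x)) ^+ 2)).
Proof.
move=> bX bp bq q0 c0 t0 pq Xt p1 q1.
set a := \int[mu]_(x in D) (X x * p x).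
set b := \int[mu]_(x in D) (X x * q x).
set a2 := \int[mu]_(x in D) (X x ^+ 2 * p x).
set b2 := \int[mu]_(x in D) (X x ^+ 2 * q x).
pose k := 3 / 2 * t.
have bXp : bmfun D (fun x => X x * p x) by exact: bmfunM.
have bXq : bmfun D (fun x => X x * q x) by exact: bmfunM.
have bX2p : bmfun D (fun x => X x ^+ 2 * p x) by apply: bmfunM => //; exact: bmfunX.
have bX2q : bmfun D (fun x => X x ^+ 2 * q x) by apply: bmfunM => //; exact: bmfunX.
(* One integration of a nonnegative combination of the six moments, with [p] and [q] of mean 1. It
   is applied in y for fixed x, and then in x. *)
have lin c0' c1 c2 c3 c4 c5 :
    (forall x, D x -> 0 <= c0' * p x + c1 * (X x * p x) + c2 * (X x ^+ 2 * p x)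
      + c3 * q x + c4 * (X x * q x) + c5 * (X x ^+ 2 * q x)) ->
    0 <= c0' + c1 * a + c2 * a2 + c3 + c4 * b + c5 * b2.
  move=> H; rewrite -[c0' in X in _ <= X]mulr1 -[c3]mulr1 -[in X in c0' * X]p1.
  rewrite -[in X in c3 * X]q1 /a /a2 /b /b2 -mean_lin6//.
  exact: Rintegral_ge0.
have Q x y : D x -> D y ->
    0 <= k * (X x - X y) ^+ 2 * (p x * p y + q x * q y)
         - (X x - X y) * (p x * q y - q x * p y).
  move=> Dx Dy; rewrite (pq _ Dx) (pq _ Dy).
  have := @mul_expR_sub_le t (X x - X y) t0 (Xt _ _ Dx Dy).
  set u := t * (X x - X y); set e := expR (t * (X x + X y)) => hu.
  have -> : expR (2 * t * X x) = e * expR u by rewrite -expRD; congr expR; rewrite /u; ring.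
  have -> : expR (2 * t * X y) = e * expR (- u) by rewrite -expRD; congr expR; rewrite /u; ring.
  have eu : expR u * expR (- u) = 1 by rewrite -expRD subrr expR0.
  have e0 : 0 <= e by exact: expR_ge0.
  have qq : 0 <= q x * q y by rewrite mulr_ge0// q0.
  have amgm : 2 * (c * e) <= (c * e) ^+ 2 + 1 by have := sqr_ge0 (c * e - 1); nra.
  have h0 : 0 <= k * (X x - X y) ^+ 2 by rewrite mulr_ge0 ?sqr_ge0// /k; nra.
  rewrite (_ : _ - _ = q x * q y *
     (k * (X x - X y) ^+ 2 * ((c * e) ^+ 2 * (expR u * expR (- u)) + 1)
      - c * e * ((X x - X y) * (expR u - expR (- u))))); last by ring.
  rewrite mulr_ge0// eu mulr1 subr_ge0.
  apply: (@le_trans _ _ (c * e * (3 * t * (X x - X y) ^+ 2))).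
    by rewrite ler_wpM2l// mulr_ge0.
  apply: le_trans (ler_wpM2l h0 amgm); rewrite /k; lra.
have Q1 x : D x -> 0 <= (k * p x * X x ^+ 2 + X x * q x)
    + (- (2 * k * p x * X x) - q x) * a + k * p x * a2
    + (k * q x * X x ^+ 2 - X x * p x) + (p x - 2 * k * q x * X x) * b
    + k * q x * b2.
  move=> Dx; apply: lin => y Dy; apply: le_trans (Q x y Dx Dy) _.
  by rewrite le_eqVlt; apply/orP; left; apply/eqP; ring.
have Q2 : forall x, D x -> 0 <= (k * a2 + b) * p x
    + (- 2 * k * a - 1) * (X x * p x) + k * (X x ^+ 2 * p x)
    + (k * b2 - a) * q x + (1 - 2 * k * b) * (X x * q x)
    + k * (X x ^+ 2 * q x).
  move=> x Dx; apply: le_trans (Q1 x Dx) _.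
  by rewrite le_eqVlt; apply/orP; left; apply/eqP; ring.
have {Q2}h := lin _ _ _ _ _ _ Q2.
(* The double integral counts each variance and the difference [a - b] twice, hence the factor 2. *)
rewrite -subr_ge0 -(pmulr_rge0 _ (ltr0Sn R 1)).
by apply: le_trans h _; rewrite le_eqVlt; apply/orP; left; apply/eqP; rewrite -/k; ring.
Qed.

End tilting.

(** * Monotonicity and restriction of extended-valued integrals *)

Section integrals.
Local Open Scope ereal_scope.
Context d (T : measurableType d) (R : realType).

(** Positive and negative parts are compared separately, which covers functions of varying sign with
    infinite integrals, such as the logarithm of a density. *)
Lemma le_integral_measurable (mu : {measure set T -> \bar R}) (D : set T)
    (f g : T -> \bar R) : measurable D ->
  measurable_fun D f -> measurable_fun D g -> (forall x, D x -> f x <= g x) ->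
  \int[mu]_(x in D) f x <= \int[mu]_(x in D) g x.
Proof.
move=> mD mf mg fg; have fg' : {in D, forall x, f x <= g x}.
  by move=> x; rewrite inE; exact: fg.
rewrite integralE [leRHS]integralE leeB//.
- apply: ge0_le_integral => //.
  + exact: measurable_funepos.
  + exact: measurable_funepos.
  + by move=> x /mem_set; exact: funepos_le.
- apply: ge0_le_integral => //.
  + exact: measurable_funeneg.
  + exact: measurable_funeneg.
  + by move=> x /mem_set; exact: funeneg_le.
Qed.

Lemma probability_setC0 (mu : probability T R) (D : set T) :
  measurable D -> mu D = 1 -> mu (~` D) = 0.
Proof. by move=> mD muD; rewrite probability_setC// [X in _ - X]muD subee. Qed.

Lemma ge0_integral_full (mu : probability T R) (D : set T) (f : T -> \bar R) :
  measurable D -> mu D = 1 -> measurable_fun setT f -> (forall x, 0 <= f x) ->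
  \int[mu]_x f x = \int[mu]_(x in D) f x.
Proof.
move=> mD muD mf f0.
rewrite (integral_mkcond D); apply: ge0_ae_eq_integral => //.
- by apply/(measurable_restrictT _ mD).1; exact: measurable_funTS.
- by move=> x _; rewrite patchE; case: ifP.
exists (~` D); split; [exact: measurableC|exact: probability_setC0|].
move=> x /= h Dx; apply: h => _; by rewrite patchE mem_set.
Qed.

End integrals.

(** * The posterior as a density with respect to the prior *)

Section posterior.
Context (R : realType) (K n : nat).
Variables (D : set 'M[R]_(K, n)) (mD : measurable D).
Variables (prior : probability 'M[R]_(K, n) R) (priorD : prior D = 1%E).
Variables (tau : R) (tau0 : 0 < tau).
Implicit Types (Y : 'M[R]_(K, n)) (f : 'M[R]_(K, n) -> R).

Lemma ell_ge0 (F G : 'M[R]_(K, n)) : 0 <= ell F G.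
Proof. by rewrite mulr_ge0 ?invr_ge0 ?ler0n ?sqr_ge0. Qed.

Lemma gibbs_weight_le1 Y F : gibbs_weight tau Y F <= 1.
Proof.
rewrite -expR0 ler_expR mulNr oppr_le0 mulr_ge0 ?ell_ge0//.
by rewrite invr_ge0 mulr_ge0// ltW.
Qed.

Lemma gibbs_weight_gt0 Y F : 0 < gibbs_weight tau Y F.
Proof. exact: expR_gt0. Qed.

Lemma bmfun_gibbs_weight Y : bmfun D (gibbs_weight tau Y).
Proof.
split; first by apply: measurable_funTS; exact: measurable_gibbs_weight.
by exists 1 => F _; rewrite ger0_norm ?gibbs_weight_le1// ltW// gibbs_weight_gt0.
Qed.

(** The partition function as a real number. Restricting to [D] loses no mass, because the prior is
    carried by [D]. *)
Definition normalization Y : R := \int[prior]_(F in D) gibbs_weight tau Y F.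

Lemma gibbs_measureT_normalization Y :
  gibbs_measure prior tau Y setT = (normalization Y)%:E.
Proof.
rewrite -bmfun_integralE//; last exact: bmfun_gibbs_weight.
apply: ge0_integral_full => //.
  by apply/measurable_EFinP; exact: measurable_gibbs_weight.
by move=> F; rewrite lee_fin ltW// gibbs_weight_gt0.
Qed.

Lemma normalization_gt0 Y : 0 < normalization Y.
Proof.
have /andP[] := @gibbs_measureT R K n prior tau Y tau0.
by rewrite gibbs_measureT_normalization lte_fin.
Qed.

Lemma posterior_dominated Y : posterior prior tau Y `<< prior.
Proof.
apply/null_content_dominatesP => A mA A0.
rewrite posteriorE// /gibbs_measure null_set_integral ?mul0e//.
by apply: measurable_funTS; apply/measurable_EFinP; exact: measurable_gibbs_weight.
Qed.

Lemma posterior_full Y : posterior prior tau Y D = 1%E.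
Proof.
rewrite posteriorE// gibbs_measureT_normalization /gibbs_measure.
rewrite bmfun_integralE//; last exact: bmfun_gibbs_weight.
by rewrite -EFinM /= divff// gt_eqF// normalization_gt0.
Qed.

(** The explicit density of the posterior with respect to the prior. *)
Definition tilt Y F : R := gibbs_weight tau Y F / normalization Y.

Lemma bmfun_tilt Y : bmfun D (tilt Y).
Proof.
apply: (@bmfunM _ _ _ _ _ (fun=> (normalization Y)^-1)); first exact: bmfun_gibbs_weight.
exact: bmfun_cst.
Qed.

(** The Radon-Nikodym derivative and [tilt] have the same integral over every measurable subset of
    [D], hence agree almost everywhere there. Means under different posteriors thus become integrals
    against one prior. *)
Lemma mean_posterior Y f : bmfun D f ->
  \int[posterior prior tau Y]_(F in D) f F = \int[prior]_(F in D) (f F * tilt Y F).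
Proof.
move=> bf; congr fine; set nu := posterior prior tau Y.
rewrite -(Radon_Nikodym_change_of_variables (posterior_dominated Y))//; last first.
  exact: bmfun_integrable.
have bt := bmfun_tilt Y.
have mf : measurable_fun D (EFin \o f) by apply/measurable_EFinP; case: bf.
have mt : measurable_fun D (EFin \o tilt Y) by apply/measurable_EFinP; case: bt.
apply: ae_eq_integral => //.
- apply: emeasurable_funM => //; apply: measurable_funTS.
  by apply: measurable_int; apply: Radon_Nikodym_integrable; exact: posterior_dominated.
- by apply/measurable_EFinP; case: (bmfunM bf bt).
- have : ae_eq prior D
    (Radon_Nikodym (charge_of_finite_measure nu) prior) (EFin \o tilt Y).
    apply: integral_ae_eq => //.
      apply: (integrableS measurableT) => //.
      by apply: Radon_Nikodym_integrable; exact: posterior_dominated.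
    move=> E ED mE; rewrite -Radon_Nikodym_integral//; last exact: posterior_dominated.
    rewrite /= posteriorE// gibbs_measureT_normalization/= /gibbs_measure.
    rewrite muleC -integralZl//; last first.
      apply: (integrableS mD) => //; apply: bmfun_integrable => //.
      exact: bmfun_gibbs_weight.
    by apply: eq_integral => F _ /=; rewrite -EFinM mulrC.
  by apply: filterS => F /= + DF => /(_ DF) ->.
Qed.

Lemma mean_tilt Y : \int[prior]_(F in D) tilt Y F = 1.
Proof.
rewrite -[RHS](mean_cst mD (posterior_full Y) 1) mean_posterior//; last exact: bmfun_cst.
by apply: eq_Rintegral => F _; rewrite mul1r.
Qed.

(* This says that the relative entropy of the posterior is nonnegative. *)
Lemma mean_posterior_ell_le Y : bmfun D (fun F => ell F Y) ->
  \int[posterior prior tau Y]_(F in D) ell F Y <= - (2 * tau) * ln (normalization Y).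
Proof.
move=> bl; have Z0 := normalization_gt0 Y.
have t0 : 0 < 2 * tau by rewrite mulr_gt0.
(* This is w ln w >= w - 1 at w = [tilt Y F], rewritten through ln w = - ell / (2 tau) - ln Z. The
   term with 1 - w has prior mean 0. *)
have key F : D F -> ell F Y * tilt Y F <=
    - (2 * tau) * ln (normalization Y) * tilt Y F + 2 * tau * (1 - tilt Y F).
  move=> DF; set l := ln _.
  have hE : tilt Y F = expR (- (2 * tau)^-1 * ell F Y - l).
    by rewrite expRD expRN lnK ?posrE.
  rewrite hE; set v := - _ * _ - l.
  have -> : ell F Y = - (2 * tau) * (v + l) by rewrite /v; field; rewrite gt_eqF.
  have := expR_ge1Dx (- v); rewrite expRN => h.
  have h2 : (1 - v) * expR v <= 1 by rewrite -ler_pdivlMr ?expR_gt0// div1r.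
  nra.
have b1 := bmfun_cst D (1 : R); have bt := bmfun_tilt Y.
rewrite mean_posterior//.
have -> : - (2 * tau) * ln (normalization Y) = \int[prior]_(F in D)
   (- (2 * tau) * ln (normalization Y) * tilt Y F + 2 * tau * (1 - tilt Y F)).
  rewrite meanD//; [|exact: bmfunZ|by apply: bmfunZ; exact: bmfunB].
  rewrite !meanZ//; last exact: bmfunB.
  by rewrite meanB// mean_cst// mean_tilt subrr mulr0 addr0 mulr1.
apply: mean_le => //; first exact: bmfunM.
by apply: bmfunD; apply: bmfunZ => //; exact: bmfunB.
Qed.

End posterior.

(** * Variational lower bound for the Kullback-Leibler divergence *)

Section variational.
Local Open Scope ereal_scope.
Context d (T : measurableType d) (R : realType).
Implicit Types (p q : probability T R).

Lemma dominates_ae p q (Q : T -> Prop) :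
  p `<< q -> {ae q, forall x, Q x} -> {ae p, forall x, Q x}.
Proof.
move=> /null_content_dominatesP pq [N [mN N0 QN]].
by exists N; split => //; exact: pq.
Qed.

Lemma Rintegral_subset_full p (D E : set T) (f : T -> R) :
  measurable D -> measurable E -> E `<=` D -> p E = 1 -> bmfun D f ->
  (\int[p]_(x in D) f x = \int[p]_(x in E) f x)%R.
Proof.
move=> mD mE ED pE bf; congr fine.
rewrite (@negligible_integral _ _ _ p D (~` E))//; last 3 first.
- exact: measurableC.
- exact: bmfun_integrable.
- exact: probability_setC0.
by congr (integral _ _ _); rewrite setDE setCK; apply/setIidPr.
Qed.

Let ln_tangent (r u l : R) : (0 < r)%R ->
  (u - l + 1 - expR (u - l - ln r) <= ln r)%R.
Proof.
move=> r0; have := expR_ge1Dx (u - l - ln r); lra.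
Qed.

(* With f = dp/dq, the tangent bound u - ln Z + 1 - expR u / (Z f) <= ln f holds
   where f > 0, hence p-a.e., and the last term on its left has p-mean at most 1.
   As ln f need not be p-integrable, only monotonicity of the integral is used. *)
Lemma mean_sub_ln_mean_expR_le_KL p q (D : set T) (u : T -> R) :
  measurable D -> p D = 1 -> bmfun D u -> bmfun D (expR \o u) ->
  (0 < \int[q]_(x in D) expR (u x))%R ->
  (\int[p]_(x in D) u x - ln (\int[q]_(x in D) expR (u x)))%:E <= KL p q.
Proof.
move=> mD pD bu beu; set Z := (\int[q]_(x in D) expR (u x))%R => Z0.
rewrite /KL; case: ifPn => [/asboolP pq|_]; last by rewrite leey.
(* Two versions of dp/dq: [g] is the one in the definition of [KL], while [f] is nonnegative and
   finite everywhere. They agree q-a.e., hence p-a.e. by domination. *)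
set g := Radon_Nikodym _ _; pose f := Radon_Nikodym_SigmaFinite.f p q.
have f0 x : 0 <= f x by exact: Radon_Nikodym_SigmaFinite.f_ge0.
have ff x : f x \is a fin_num by exact: Radon_Nikodym_SigmaFinite.f_fin_num.
have gf x : g x \is a fin_num by exact: Radon_Nikodym_fin_num.
have mf : measurable_fun setT f.
  exact: (measurable_int _ (Radon_Nikodym_SigmaFinite.f_integrable pq)).
have mg : measurable_fun setT g.
  by apply: measurable_int; exact: Radon_Nikodym_integrable.
pose r x := fine (f x).
have fr x : f x = (r x)%:E by rewrite /r fineK.
have r0 x : (0 <= r x)%R by rewrite -lee_fin -fr.
have mr : measurable_fun setT r by exact: measurableT_comp.
have mP : measurable [set x | (0 < r x)%R].
  rewrite (_ : [set _ | _] = r @^-1` `]0%R, +oo[%classic); last first.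
    by apply/seteqP; split => x /=; rewrite in_itv/= andbT.
  by rewrite -[X in measurable X]setTI; exact: mr.
pose E := D `&` [set x | (0 < r x)%R].
have mE : measurable E by exact: measurableI.
have ED : E `<=` D by move=> x [].
(* The set where [f] vanishes has p-measure equal to the q-integral of 0 over it. *)
have pE : p E = 1.
  have pN : p (~` [set x | (0 < r x)%R]) = 0.
    rewrite (Radon_Nikodym_SigmaFinite.f_integral pq)//; last exact: measurableC.
    rewrite -[RHS](integral0 q (~` [set x | (0 < r x)%R])).
    apply: eq_integral => x; rewrite inE/= => /negP; rewrite -leNgt => rx.
    by rewrite -/f fr; congr EFin; apply/eqP; rewrite eq_le rx r0.
  have pDN : p (D `&` ~` [set x | (0 < r x)%R]) = 0.
    have mC := measurableC mP.
    by apply: subset_measure0 pN => //; exact: measurableI.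
  rewrite -pD -(setIT D) -(setvU [set x | (0 < r x)%R]) setIUr.
  rewrite measureU//; [by rewrite [X in _ = (X + _)%E]pDN add0e|by apply: measurableI => //; exact: measurableC|].
  by rewrite setIACA setIid setICl setI0.
have mlr : measurable_fun setT (fun x => (ln (r x))%:E).
  by apply/measurable_EFinP; exact: measurableT_comp.
(* On [E] the density is positive, so the extended logarithm is the real one; the complement of [E]
   is p-null. *)
have -> : \int[p]_x lne (g x) = \int[p]_(x in E) (ln (r x))%:E.
  rewrite [RHS]integral_mkcond; apply: ae_eq_integral => //.
  - rewrite (_ : (fun _ => _) =
        fun x => if (fine (g x) <= 0)%R then -oo else (ln (fine (g x)))%:E); last first.
      by apply/funext => x; rewrite -[g x in LHS]fineK.
    apply: measurable_fun_ifT => //.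
      by apply: measurable_fun_ler => //; exact: measurableT_comp.
    by apply/measurable_EFinP; do 2 apply: measurableT_comp => //.
  - by apply/(measurable_restrictT _ mE).1; exact: measurable_funTS.
  have h1 : {ae p, forall x, E x}.
    by exists (~` E); split => //; [exact: measurableC|exact: probability_setC0].
  have h2 : {ae p, forall x, f x = g x}.
    apply: (dominates_ae pq).
    have := ae_eq_Radon_Nikodym_SigmaFinite pq measurableT.
    by apply: filterS => x /= /(_ I).
  apply: filterS2 h1 h2 => x Ex fg _; rewrite patchE mem_set//= -fg fr lne_EFin//.
  by case: Ex.
pose h x := expR (u x - ln Z - ln (r x))%R.
have h0 x : (0 <= h x)%R by exact: expR_ge0.
have bE (v : T -> R) : bmfun D v -> bmfun E v.
  move=> [mv [M vM]]; split; first exact: measurable_funS mv.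
  by exists M => x /ED; exact: vM.
have mh : measurable_fun E h.
  apply: measurableT_comp => //; apply: measurable_funB.
    by apply: measurable_funB => //; case: (bE _ bu).
  by apply: measurable_funTS; exact: measurableT_comp.
(* Passing from p to q multiplies [h] by the density, which cancels the factor expR (- ln (r x)) and
   leaves e^u / Z. Enlarging [E] to [D] then gives Z / Z. *)
have ih : \int[p]_(x in E) (h x)%:E <= 1.
  rewrite -(Radon_Nikodym_SigmaFinite.change_of_variables pq)//; last exact/measurable_EFinP.
  rewrite (eq_integral (fun x => (Z^-1 * expR (u x))%:E)); last first.
    move=> x; rewrite inE => -[_ /= rx]; rewrite -/f fr -EFinM /h.
    by rewrite !expRB !lnK ?posrE// divfK ?gt_eqF// mulrC.
  apply: (@le_trans _ _ (\int[q]_(x in D) (Z^-1 * expR (u x))%:E)).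
    apply: ge0_subset_integral => //.
      by apply/measurable_EFinP; case: (bmfunZ Z^-1 beu).
    by move=> x _; rewrite lee_fin mulr_ge0 ?expR_ge0// invr_ge0 ltW.
  rewrite bmfun_integralE//; last exact: (bmfunZ Z^-1 beu).
  by rewrite meanZ// -/Z mulVf// gt_eqF.
have hi : p.-integrable E (EFin \o h).
  apply/integrableP; split; first exact/measurable_EFinP.
  under eq_integral do rewrite /= ger0_norm//.
  exact: le_lt_trans ih (ltry _).
have bv : bmfun E (fun x => u x - ln Z + 1)%R.
  by apply: bE; apply: bmfunD; [apply: bmfunB => //|]; exact: bmfun_cst.
apply: (@le_trans _ _ (\int[p]_(x in E) ((u x - ln Z + 1)%:E - (h x)%:E))).
  rewrite integralB_EFin//; last exact: bmfun_integrable.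
  rewrite bmfun_integralE//.
  rewrite meanD//; [|exact: (bmfunB (bE _ bu) (bmfun_cst _ _))|exact: bmfun_cst].
  rewrite meanB//; [|exact: bE|exact: bmfun_cst].
  rewrite !(mean_cst mE pE) (Rintegral_subset_full mD mE ED pE bu).
  set m := (\int[p]_(x in E) u x)%R.
  have : \int[p]_(x in E) (h x)%:E \is a fin_num by exact: integrable_fin_num.
  move: ih; case: (\int[p]_(x in E) (h x)%:E) => [s| |]// + _.
  by rewrite -EFinB !lee_fin; lra.
apply: le_integral_measurable => //.
- by apply/measurable_EFinP; apply: measurable_funB => //; case: bv.
- exact: measurable_funTS.
- by move=> x [_ /= rx]; rewrite -EFinB lee_fin; exact: ln_tangent.
Qed.

End variational.

(** * Matrix norms, the Cauchy-Schwarz inequality and column scalings *)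

Section matrices.
Context (R : realType) (K n : nat).
Implicit Types (F G : 'M[R]_(K, n)).

Lemma enorm_sqr m (v : 'cV[R]_m) : enorm v ^+ 2 = \sum_k v k 0 ^+ 2.
Proof. by rewrite sqr_sqrtr// sumr_ge0// => k _; exact: sqr_ge0. Qed.

Lemma ell_sum F G : ell F G = n%:R^-1 * \sum_i \sum_k (F k i - G k i) ^+ 2.
Proof.
rewrite ellE; congr (_ * _); apply: eq_bigr => i _; rewrite enorm_sqr.
by apply: eq_bigr => k _; rewrite !mxE.
Qed.

Lemma coord_sqr_le (v : 'cV[R]_K) k : v k 0 ^+ 2 <= enorm v ^+ 2.
Proof.
rewrite enorm_sqr (bigD1 k)//= lerDl sumr_ge0// => j _; exact: sqr_ge0.
Qed.

Lemma norm_le_1D_sqr (a c : R) : a ^+ 2 <= c -> `|a| <= 1 + c.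
Proof.
move=> ac; have := sqr_ge0 (`|a| - 1); rewrite -real_normK ?num_real// in ac; nra.
Qed.

(** The quadratic t^2 A - 2 t C + E is a sum of squares; it is evaluated at its minimizer t = C / A,
    the case A = 0 being separate. *)
Lemma cauchy_schwarz_sum m (a b : 'I_m -> R) :
  (\sum_k a k * b k) ^+ 2 <= (\sum_k a k ^+ 2) * (\sum_k b k ^+ 2).
Proof.
set A := \sum_k a k ^+ 2; set C := \sum_k a k * b k; set E := \sum_k b k ^+ 2.
have A0 : 0 <= A by apply: sumr_ge0 => k _; exact: sqr_ge0.
have key t : 0 <= t ^+ 2 * A - 2 * t * C + E.
  rewrite (_ : _ + _ = \sum_k (t * a k - b k) ^+ 2).
    by apply: sumr_ge0 => k _; exact: sqr_ge0.
  rewrite /A /C /E !mulr_sumr -sumrB -big_split/=.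
  by apply: eq_bigr => k _; ring.
have [A00|An0] := eqVneq A 0.
  have a0 k : a k = 0.
    have /eqP := A00; rewrite psumr_eq0 => [/allP/(_ k)|j _]; last exact: sqr_ge0.
    by rewrite mem_index_enum sqrf_eq0 => /(_ isT)/eqP.
  rewrite A00 mul0r /C big1 ?expr0n// => k _; by rewrite a0 mul0r.
have Ap : 0 < A by rewrite lt_neqAle eq_sym An0.
have := key (C / A); rewrite -(pmulr_rge0 _ Ap).
have -> : A * ((C / A) ^+ 2 * A - 2 * (C / A) * C + E) = A * E - C ^+ 2 by field.
by rewrite subr_ge0.
Qed.

(** Matrix neighbourhoods are generated by entrywise ones, and each entry is multiplied by a
    constant. Continuity yields measurability because the sigma-algebra is Borel. *)
Lemma continuous_scale_cols (s : 'I_n -> R) :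
  continuous (scale_cols s : 'M[R]_(K, n) -> 'M[R]_(K, n)).
Proof.
move=> F A [P FP PA]; exists (fun k i => (fun y => s i * y) @^-1` P k i).
  move=> k i; have := FP k i; rewrite mxE => Pki.
  exact: (@mulrl_continuous _ (s i) (F k i) _ Pki).
by move=> G /= PG; apply: PA => k i; rewrite mxE; exact: PG.
Qed.

Lemma measurable_scale_cols (s : 'I_n -> R) :
  measurable_fun [set: 'M[R]_(K, n)] (scale_cols s : 'M[R]_(K, n) -> 'M[R]_(K, n)).
Proof.
apply: (measurability (@open 'M[R]_(K, n))) => // _ [A oA <-].
rewrite setTI; apply: sub_sigma_algebra.
by apply: open_comp => // F _; exact: continuous_scale_cols.
Qed.

Section bounded_coordinates.
Context d (T : measurableType d) (D : set T).

Lemma measurable_fun_ell (F G : T -> 'M[R]_(K, n)) :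
  (forall k i, measurable_fun D (fun x => F x k i)) ->
  (forall k i, measurable_fun D (fun x => G x k i)) ->
  measurable_fun D (fun x => ell (F x) (G x)).
Proof.
move=> mF mG; under eq_fun do rewrite ell_sum.
apply: measurable_funM => //; apply: measurable_sum => i.
apply: measurable_sum => k; apply: measurable_funX; exact: measurable_funB.
Qed.

Lemma bmfun_ell (F G : T -> 'M[R]_(K, n)) :
  (forall k i, bmfun D (fun x => F x k i)) ->
  (forall k i, bmfun D (fun x => G x k i)) ->
  bmfun D (fun x => ell (F x) (G x)).
Proof.
move=> mF mG; under eq_fun do rewrite ell_sum.
apply: bmfunZ; apply: bmfun_sum => i; apply: bmfun_sum => k.
by apply: bmfunX; exact: bmfunB.
Qed.

End bounded_coordinates.

Lemma bmfun_coord (D : set 'M[R]_(K, n)) (F0 : 'M[R]_(K, n)) (c : R) :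
  measurable D ->
  (forall F i, D F -> enorm (col i F - col i F0) ^+ 2 <= c) ->
  forall k i, bmfun D (fun F : 'M[R]_(K, n) => F k i).
Proof.
move=> mD Dc k i; split.
  by apply: measurable_funTS; exact: measurable_mx_coord.
exists (`|F0 k i| + (1 + c)) => F DF.
rewrite -[F k i](subrK (F0 k i)) addrC (le_trans (ler_normD _ _))// lerD2l.
apply: norm_le_1D_sqr; apply: le_trans (Dc F i DF).
by apply: le_trans (coord_sqr_le _ k); rewrite !mxE.
Qed.

End matrices.

(** * Measurability of posterior means in the noise *)

Section measurable_posterior_mean.
Context (R : realType) (K n : nat).
Variables (D : set 'M[R]_(K, n)) (mD : measurable D).
Variables (prior : probability 'M[R]_(K, n) R) (priorD : prior D = 1%E).
Variables (tau : R) (tau0 : 0 < tau) (Fstar : 'M[R]_(K, n)).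
Local Notation M := 'M[R]_(K, n).

Let measurable_gibbs_weight2 : measurable_fun [set: M * M]
  (fun z => gibbs_weight tau (Fstar + z.1) z.2).
Proof.
apply: measurableT_comp => //; apply: measurable_funM => //.
apply: (@measurable_fun_ell _ _ _ _ _ _ (fun z : M * M => z.2)
  (fun z => Fstar + z.1)) => k i.
  apply: (@measurableT_comp _ _ _ _ _ _ (fun F : M => F k i)) => //.
  exact: measurable_mx_coord.
under eq_fun do rewrite mxE; apply: measurable_funD => //.
apply: (@measurableT_comp _ _ _ _ _ _ (fun F : M => F k i)) => //.
exact: measurable_mx_coord.
Qed.

(** Tonelli's theorem: the Gibbs weight is jointly measurable in noise and matrix, and a partial
    integral of a nonnegative jointly measurable function is measurable. The function [f] is
    extended by 0 outside [D]. *)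
Let measurable_ge0_mean_gibbs (f : M -> R) :
  measurable_fun D f -> (forall F, D F -> 0 <= f F) ->
  measurable_fun [set: M] (fun x =>
    \int[prior]_(F in D) (f F * gibbs_weight tau (Fstar + x) F)).
Proof.
move=> mf f0; apply: measurableT_comp => //.
pose h (z : M * M) := ((f \_ D) z.2 * gibbs_weight tau (Fstar + z.1) z.2)%:E.
rewrite (_ : (fun _ => _) = fubini_F prior h).
  apply: measurable_fun_fubini_tonelli_F.
    apply/measurable_EFinP; apply: measurable_funM => //.
    apply: (@measurableT_comp _ _ _ _ _ _ (f \_ D)) => //.
    exact: (measurable_restrictT f mD).1 mf.
  move=> z; rewrite lee_fin mulr_ge0//; last by rewrite ltW// gibbs_weight_gt0.
  by rewrite patchE; case: ifPn => //; rewrite inE; exact: f0.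
apply/funext => x; rewrite integral_mkcond /fubini_F; apply: eq_integral => F _.
by rewrite /h/= !patchE; case: ifPn => //; rewrite mul0r.
Qed.

Lemma measurable_normalization :
  measurable_fun [set: M] (fun x => normalization D prior tau (Fstar + x)).
Proof.
rewrite (_ : (fun _ => _) = fun x =>
    \int[prior]_(F in D) (1 * gibbs_weight tau (Fstar + x) F)).
  by apply: measurable_ge0_mean_gibbs => //; exact: measurable_cst.
by apply/funext => x; apply: eq_Rintegral => F _; rewrite mul1r.
Qed.

Lemma measurable_posterior_mean (f : M -> R) : bmfun D f ->
  measurable_fun [set: M] (fun x =>
    \int[posterior prior tau (Fstar + x)]_(F in D) f F).
Proof.
move=> bf; have [mf [c fc]] := bf.
pose Z x := normalization D prior tau (Fstar + x).
have mZ : measurable_fun setT Z by exact: measurable_normalization.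
(* Adding the bound [c] makes the integrand nonnegative, as Tonelli requires. The inverse of Z > 0
   is written as expR (- ln Z), a composition of measurable maps. *)
rewrite (_ : (fun _ => _) = fun x => expR (- ln (Z x)) *
   (\int[prior]_(F in D) ((f F + c) * gibbs_weight tau (Fstar + x) F)) - c).
  apply: measurable_funB => //; apply: measurable_funM.
    by apply: measurableT_comp => //; apply: measurableT_comp => //; exact: measurableT_comp.
  apply: measurable_ge0_mean_gibbs; first exact: measurable_funD.
  by move=> F /fc; rewrite ler_norml -lerBlDr sub0r => /andP[].
apply/funext => x; rewrite mean_posterior//.
have Z0 : 0 < Z x by exact: normalization_gt0.
have bg := bmfun_gibbs_weight D tau0 (Fstar + x).
have bfg := bmfunM bf bg.
rewrite (_ : \int[prior]_(F in D) ((f F + c) * _) =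
    \int[prior]_(F in D) (f F * gibbs_weight tau (Fstar + x) F) + c * Z x).
  rewrite expRN lnK ?posrE// mulrDr mulrCA mulVf ?gt_eqF// mulr1 addrK.
  rewrite -meanZ//; apply: eq_Rintegral => F _.
  by rewrite /tilt mulrA mulrC.
rewrite -meanZ// -meanD//; last exact: bmfunZ.
by apply: eq_Rintegral => F _; rewrite mulrDl.
Qed.

End measurable_posterior_mean.

(** * Deterministic analysis of the aggregate for a fixed noise matrix *)

Section aggregate.
Context (R : realType) (n K : nat).
Variables (n_gt0 : (0 < n)%N).
Local Notation M := 'M[R]_(K, n).
Variables (D : set M) (mD : measurable D).
Variables (prior : probability M R) (priorD : prior D = 1%E).
Variables (B L : R) (B0 : 0 < B) (L0 : 0 < L).
Variable (D_bounded : forall F F' : M, D F -> D F' -> forall i : 'I_n,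
  enorm (col i F - col i F') ^+ 2 <= K%:R * L ^+ 2).
Variables (tau : R) (tau0 : 0 < tau) (Fstar : M).

Local Notation post x := (posterior prior tau (Fstar + x)).

(** A function of the noise value [x], so that sign flips act on its argument and expectations
    become integrals over the law of the noise. *)
Definition ewa (x : M) : M := EWA prior tau (Fstar + x) D.

(** The trace of the posterior covariance matrix of column [i]. *)
Definition column_variance (i : 'I_n) (x : M) : R :=
  \sum_k \int[post x]_(F in D) ((F k i - ewa x k i) ^+ 2).

Definition posterior_spread (x : M) : R :=
  \int[post x]_(F in D) ell (ewa x) F.

(** Prior mass 1 makes [D] nonempty, and the diameter bound around one of its points bounds every
    entry. *)
Lemma bmfun_prior_coord k i : bmfun D (fun F : M => F k i).
Proof.
have [F0 DF0] : D !=set0.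
  apply/set0P; apply/eqP => D0; have := priorD; rewrite D0 measure0 => /esym/eqP.
  by rewrite onee_eq0.
by apply: (@bmfun_coord _ _ _ _ F0) => // F j DF; exact: D_bounded.
Qed.

Let bc := bmfun_prior_coord.

Let postD x : post x D = 1%E. Proof. exact: posterior_full. Qed.

Lemma ewaE x k i : ewa x k i = \int[post x]_(F in D) F k i.
Proof. by rewrite mxE. Qed.

Lemma measurable_ewa k i : measurable_fun [set: M] (fun x => ewa x k i).
Proof. by under eq_fun do rewrite ewaE; exact: measurable_posterior_mean. Qed.

Lemma bmfun_ewa (A : set M) k i : bmfun A (fun x => ewa x k i).
Proof.
split; first by apply: measurable_funTS; exact: measurable_ewa.
have [_ [c fc]] := bmfun_prior_coord k i.
by exists c => x _; rewrite ewaE; exact: mean_norm_le.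
Qed.

Let bcst (A : set M) (c : R) : bmfun A (fun=> c). Proof. exact: bmfun_cst. Qed.

Let column_varianceE i x : column_variance i x =
  \sum_k (\int[post x]_(F in D) (F k i ^+ 2) - ewa x k i ^+ 2).
Proof. by apply: eq_bigr => k _; rewrite ewaE mean_variance. Qed.

Lemma bmfun_column_variance (A : set M) i : bmfun A (column_variance i).
Proof.
rewrite (_ : column_variance i = fun x =>
  \sum_k (\int[post x]_(F in D) (F k i ^+ 2) - ewa x k i ^+ 2)); last first.
  by apply/funext => x; exact: column_varianceE.
apply: bmfun_sum => k; apply: bmfunB; last by apply: bmfunX; exact: bmfun_ewa.
have b2 : bmfun D (fun F : M => F k i ^+ 2) by exact: bmfunX.
split; first by apply: measurable_funTS; exact: measurable_posterior_mean.
by have [_ [c fc]] := b2; exists c => x _; exact: mean_norm_le.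
Qed.

Lemma posterior_spreadE x :
  posterior_spread x = n%:R^-1 * \sum_i column_variance i x.
Proof.
rewrite /posterior_spread.
rewrite (@eq_Rintegral _ _ _ _ _ (fun F : M =>
  n%:R^-1 * \sum_i \sum_k (F k i - ewa x k i) ^+ 2)); last first.
  move=> F _; rewrite ell_sum; congr (_ * _); apply: eq_bigr => i _.
  by apply: eq_bigr => k _; rewrite -sqrrN opprB.
have bs i : bmfun D (fun F : M => \sum_k (F k i - ewa x k i) ^+ 2).
  by apply: bmfun_sum => k; apply: bmfunX; exact: bmfunB.
rewrite meanZ//; last exact: bmfun_sum.
rewrite mean_sum//; congr (_ * _); apply: eq_bigr => i _.
by rewrite mean_sum// => k; apply: bmfunX; exact: bmfunB.
Qed.

Lemma bmfun_posterior_spread (A : set M) : bmfun A posterior_spread.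
Proof.
rewrite (_ : posterior_spread = fun x => n%:R^-1 * \sum_i column_variance i x).
  by apply: bmfunZ; apply: bmfun_sum => i; exact: bmfun_column_variance.
by apply/funext => x; exact: posterior_spreadE.
Qed.

Lemma bmfun_ell_ewa (A : set M) : bmfun A (fun x => ell (ewa x) Fstar).
Proof.
by apply: bmfun_ell => k i; [exact: bmfun_ewa|exact: bmfun_cst].
Qed.

Definition pairing (x F : M) : R := \sum_i \sum_k x k i * F k i.

Let bmfun_pairing x : bmfun D (pairing x).
Proof. by apply: bmfun_sum => i; apply: bmfun_sum => k; exact: bmfunZ. Qed.

Lemma mean_pairing (p : probability M R) x : p D = 1%E ->
  \int[p]_(F in D) pairing x F = pairing x (\matrix_(k, i) \int[p]_(F in D) F k i).
Proof.
move=> pD; rewrite mean_sum//; last first.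
  by move=> i; apply: bmfun_sum => k; exact: bmfunZ.
apply: eq_bigr => i _; rewrite mean_sum//; last by move=> k; exact: bmfunZ.
by apply: eq_bigr => k _; rewrite meanZ// mxE.
Qed.

(** Expansion of the square. The last group is free of [F], so it cancels when the means under the
    posterior and under [p] are compared. *)
Let ell_shift (F x : M) : ell F (Fstar + x) =
  ell F Fstar - 2 / n%:R * pairing x F
  + (2 / n%:R * pairing x Fstar + n%:R^-1 * \sum_i \sum_k x k i ^+ 2).
Proof.
rewrite !ell_sum /pairing; set S2 := \sum_i \sum_k x k i ^+ 2.
have -> : \sum_i \sum_k (F k i - (Fstar + x) k i) ^+ 2 =
    \sum_i \sum_k (F k i - Fstar k i) ^+ 2 - 2 * \sum_i \sum_k x k i * F k i +
    (2 * \sum_i \sum_k x k i * Fstar k i + S2).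
  rewrite !mulr_sumr -sumrB -!big_split/=; apply: eq_bigr => i _.
  rewrite !mulr_sumr -sumrB -!big_split/=; apply: eq_bigr => k _.
  by rewrite mxE; ring.
by ring.
Qed.

Let bell (G : M) : bmfun D (fun F => ell F G).
Proof. by apply: bmfun_ell => // k i; exact: bmfun_cst. Qed.

Let mean_ell_shift (p : probability M R) x : p D = 1%E ->
  \int[p]_(F in D) ell F (Fstar + x) =
  \int[p]_(F in D) ell F Fstar
  - 2 / n%:R * pairing x (\matrix_(k, i) \int[p]_(F in D) F k i)
  + (2 / n%:R * pairing x Fstar + n%:R^-1 * \sum_i \sum_k x k i ^+ 2).
Proof.
move=> pD; rewrite -mean_pairing// -meanZ// -meanB//; last exact: bmfunZ.
set c := (X in _ = _ + X).
rewrite -[c in RHS](mean_cst mD pD) -meanD//; last first.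
  by apply: bmfunB => //; exact: bmfunZ.
by apply: eq_Rintegral => F _; rewrite ell_shift.
Qed.

(** Bias-variance decomposition around the posterior mean. *)
Let mean_post_ell x : \int[post x]_(F in D) ell F Fstar =
  posterior_spread x + ell (ewa x) Fstar.
Proof.
rewrite posterior_spreadE ell_sum -mulrDr -big_split/=.
rewrite (@eq_Rintegral _ _ _ _ _ (fun F : M =>
  n%:R^-1 * \sum_i \sum_k (F k i - Fstar k i) ^+ 2)); last first.
  by move=> F _; rewrite ell_sum.
have bs i : bmfun D (fun F : M => \sum_k (F k i - Fstar k i) ^+ 2).
  by apply: bmfun_sum => k; apply: bmfunX; exact: bmfunB.
rewrite meanZ//; last exact: bmfun_sum.
rewrite mean_sum//; congr (_ * _); apply: eq_bigr => i _.
rewrite mean_sum//; last by move=> k; apply: bmfunX; exact: bmfunB.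
rewrite column_varianceE -big_split/=; apply: eq_bigr => k _.
by rewrite mean_sqB// -ewaE; ring.
Qed.

(** Both halves of the Gibbs principle involve - 2 tau ln Z: the posterior mean loss is at most this
    value, and the loss under [p] plus 2 tau KL is at least it. Here [u] is the logarithm of the
    Gibbs weight, so the mean of its exponential is Z. *)
Lemma ell_ewa_le (p : probability M R) (kl : R) x : p D = 1%E ->
  KL p prior = kl%:E ->
  ell (ewa x) Fstar + posterior_spread x <=
  \int[p]_(F in D) ell F Fstar + 2 * tau * kl
  + 2 / n%:R * (pairing x (ewa x)
                - pairing x (\matrix_(k, i) \int[p]_(F in D) F k i)).
Proof.
move=> pD klE.
have t2 : 0 < 2 * tau by rewrite mulr_gt0.
have h1 := mean_posterior_ell_le mD priorD tau0 (bell (Fstar + x)).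
pose u F := - (2 * tau)^-1 * ell F (Fstar + x).
have bu : bmfun D u by exact: bmfunZ.
have := @mean_sub_ln_mean_expR_le_KL _ M R p prior D u mD pD bu
  (bmfun_gibbs_weight D tau0 (Fstar + x)).
rewrite -/(normalization D prior tau (Fstar + x)) klE lee_fin.
move=> /(_ (normalization_gt0 mD priorD tau0 (Fstar + x))).
rewrite meanZ// => h2.
have {h1 h2} : \int[post x]_(F in D) ell F (Fstar + x) <=
    \int[p]_(F in D) ell F (Fstar + x) + 2 * tau * kl.
  apply: le_trans h1 _; rewrite -subr_ge0.
  rewrite -(@pmulr_rge0 _ (2 * tau)^-1) ?invr_gt0//.
  move: h2; rewrite -subr_ge0 => /le_trans; apply.
  by rewrite le_eqVlt; apply/orP; left; apply/eqP; field; rewrite gt_eqF.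
rewrite (mean_ell_shift x pD) (mean_ell_shift x (postD x)) mean_post_ell.
have -> : (\matrix_(k, i) \int[post x]_(F in D) F k i) = ewa x.
  by apply/matrixP => k i; rewrite !mxE.
lra.
Qed.

(** * Effect on the posterior of flipping the sign of one noise column *)

Definition flip (i j : 'I_n) : R := if j == i then -1 else 1.

Lemma flip_sign i j : flip i j = 1 \/ flip i j = -1.
Proof. by rewrite /flip; case: ifP; [right|left]. Qed.

Lemma scale_flip i j k (x : M) :
  scale_cols (flip i) x k j = if j == i then - x k j else x k j.
Proof. by rewrite mxE /flip; case: ifP => _; rewrite ?mulN1r ?mul1r. Qed.

Definition column_pairing (i : 'I_n) (x F : M) : R := \sum_k x k i * F k i.

Let bmfun_column_pairing i x : bmfun D (column_pairing i x).
Proof. by apply: bmfun_sum => k; exact: bmfunZ. Qed.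

Lemma mean_column_pairing i x y : \int[post y]_(F in D) column_pairing i x F =
  column_pairing i x (ewa y).
Proof.
rewrite mean_sum//; last by move=> k; exact: bmfunZ.
by apply: eq_bigr => k _; rewrite meanZ// ewaE.
Qed.

Lemma column_pairing_sqr_le i x F : column_pairing i x F ^+ 2 <=
  enorm (col i x) ^+ 2 * enorm (col i F) ^+ 2.
Proof.
rewrite !enorm_sqr; under [X in _ <= X * _]eq_bigr do rewrite mxE.
under [X in _ <= _ * X]eq_bigr do rewrite mxE.
exact: cauchy_schwarz_sum.
Qed.

Let column_pairingB i x F G :
  column_pairing i x F - column_pairing i x G = column_pairing i x (F - G).
Proof. by rewrite -sumrB; apply: eq_bigr => k _; rewrite !mxE; ring. Qed.

(** Cauchy-Schwarz applied to the pairing of column [i] of [x] with the deviation of [F] from its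
    posterior mean, then averaged. *)
Let variance_column_pairing_le i x y :
  enorm (col i x) ^+ 2 <= K%:R * B ^+ 2 ->
  \int[post y]_(F in D) (column_pairing i x F ^+ 2)
  - (\int[post y]_(F in D) column_pairing i x F) ^+ 2 <=
  K%:R * B ^+ 2 * column_variance i y.
Proof.
move=> xB; rewrite -mean_variance// mean_column_pairing.
have bs : bmfun D (fun F : M => \sum_k (F k i - ewa y k i) ^+ 2).
  by apply: bmfun_sum => k; apply: bmfunX; exact: bmfunB.
rewrite /column_variance -mean_sum//; last first.
  by move=> k; apply: bmfunX; exact: bmfunB.
rewrite -meanZ//; apply: mean_le => //.
- by apply: bmfunX; exact: bmfunB.
- exact: bmfunZ.
move=> F _; rewrite column_pairingB (le_trans (column_pairing_sqr_le _ _ _))//.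
rewrite [enorm (col i (F - _)) ^+ 2]enorm_sqr.
rewrite (eq_bigr (fun k => (F k i - ewa y k i) ^+ 2)) => [|k _]; last by rewrite !mxE.
by rewrite ler_wpM2r// sumr_ge0// => k _; exact: sqr_ge0.
Qed.

(** The flip keeps the squared norm of the noise and lowers the pairing with [F] by twice its column
    part. The log-weight therefore changes by 2 / (tau n) times X(F) - X([Fstar]), and only the X(F)
    part depends on [F]. *)
Let gibbs_weight_flip i x F :
  gibbs_weight tau (Fstar + x) F =
  expR (- (2 * (tau * n%:R)^-1 * column_pairing i x Fstar)) *
  expR (2 * (tau * n%:R)^-1 * column_pairing i x F) *
  gibbs_weight tau (Fstar + scale_cols (flip i) x) F.
Proof.
rewrite /gibbs_weight -!expRD; congr expR; rewrite !ell_shift.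
have -> : \sum_j \sum_k scale_cols (flip i) x k j ^+ 2 = \sum_j \sum_k x k j ^+ 2.
  apply: eq_bigr => j _; apply: eq_bigr => k _; rewrite scale_flip.
  by case: ifP => _; rewrite ?sqrrN.
have flipE G : pairing (scale_cols (flip i) x) G =
    pairing x G - 2 * column_pairing i x G.
  rewrite /pairing (bigD1 i)//= [in RHS](bigD1 i)//=.
  rewrite (eq_bigr (fun j => \sum_k x k j * G k j)); last first.
    move=> j ji; apply: eq_bigr => k _; by rewrite scale_flip (negbTE ji).
  rewrite (_ : \sum_k _ * _ = - column_pairing i x G).
    rewrite -/(column_pairing i x G); ring.
  rewrite -sumrN; apply: eq_bigr => k _; rewrite scale_flip eqxx; ring.
by rewrite !flipE; field; rewrite pnatr_eq0 -lt0n n_gt0 gt_eqF.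
Qed.

Hypothesis tauL : n%:R^-1 * (K%:R * B) * (2 * L) <= tau.

Let n0 : 0 < n%:R :> R. Proof. by rewrite ltr0n. Qed.

(** Cauchy-Schwarz gives oscillation at most K B L, and the 2 L in the temperature condition makes
    this at most tau n / 2, the threshold needed for tilting. *)
Let column_pairing_small i x F G : enorm (col i x) ^+ 2 <= K%:R * B ^+ 2 ->
  D F -> D G ->
  `|(tau * n%:R)^-1 * (column_pairing i x F - column_pairing i x G)| <= 2^-1.
Proof.
move=> xB DF DG; rewrite column_pairingB.
have h : `|column_pairing i x (F - G)| <= K%:R * B * L.
  have KBL : 0 <= K%:R * B * L by rewrite !mulr_ge0// ltW.
  rewrite -(@ler_pXn2r _ 2)// ?nnegrE// real_normK ?num_real//.
  apply: le_trans (column_pairing_sqr_le _ _ _) _.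
  rewrite (_ : (_ * _ * _) ^+ 2 = K%:R * B ^+ 2 * (K%:R * L ^+ 2)); last by ring.
  apply: ler_pM => //; rewrite ?sqr_ge0//.
  by rewrite raddfB/=; exact: D_bounded.
have tn : 0 < tau * n%:R by rewrite mulr_gt0.
rewrite normrM gtr0_norm ?invr_gt0// mulrC ler_pdivrMr//.
apply: le_trans h _; move: tauL; rewrite mulrAC -mulrA ler_pdivrMl//; lra.
Qed.

(** The tilting inequality with the prior as base measure, the two posterior densities as [p] and
    [q], and t = 1 / (tau n). *)
Lemma column_pairing_flip_le i x : enorm (col i x) ^+ 2 <= K%:R * B ^+ 2 ->
  column_pairing i x (ewa x)
  - column_pairing i x (ewa (scale_cols (flip i) x)) <=
  3 / 2 * (tau * n%:R)^-1 * (K%:R * B ^+ 2) *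
    (column_variance i x + column_variance i (scale_cols (flip i) x)).
Proof.
move=> xB; set y := scale_cols _ _.
pose X := column_pairing i x.
have bX : bmfun D X by exact: bmfun_column_pairing.
have Zx := normalization_gt0 mD priorD tau0 (Fstar + x).
have Zy := normalization_gt0 mD priorD tau0 (Fstar + y).
have t0 : 0 <= (tau * n%:R)^-1 by rewrite invr_ge0 mulr_ge0// ltW.
have [p pE] : {p | p = tilt D prior tau (Fstar + x)} by exact: exist _ _ erefl.
have [q qE] : {q | q = tilt D prior tau (Fstar + y)} by exact: exist _ _ erefl.
have bp : bmfun D p by rewrite pE; exact: bmfun_tilt.
have bq : bmfun D q by rewrite qE; exact: bmfun_tilt.
have p1 : \int[prior]_(F in D) p F = 1 by rewrite pE mean_tilt.
have q1 : \int[prior]_(F in D) q F = 1 by rewrite qE mean_tilt.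
have q0 F : D F -> 0 <= q F.
  by move=> _; rewrite qE divr_ge0 ?(ltW Zy)// ltW// gibbs_weight_gt0.
(* All factors of the density ratio that do not depend on [F], including the ratio of the partition
   functions. *)
pose c := expR (- (2 * (tau * n%:R)^-1 * X Fstar)) *
  (normalization D prior tau (Fstar + y) / normalization D prior tau (Fstar + x)).
have c0 : 0 <= c.
  apply: mulr_ge0; first exact: expR_ge0.
  by apply: divr_ge0; [exact: ltW Zy|exact: ltW Zx].
have pq F : D F -> p F = c * expR (2 * (tau * n%:R)^-1 * X F) * q F.
  have alg (a b g u v : R) : 0 < u -> 0 < v ->
      a * b * g / u = a * (v / u) * b * (g / v).
    by move=> u0 v0; field; rewrite !gt_eqF.
  by move=> _; rewrite pE qE /tilt (gibbs_weight_flip i x F); exact: alg.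
have small F G : D F -> D G -> `|(tau * n%:R)^-1 * (X F - X G)| <= 2^-1.
  by move=> DF DG; exact: column_pairing_small.
have postp f : bmfun D f ->
    \int[prior]_(F in D) (f F * p F) = \int[post x]_(F in D) f F.
  by move=> bf; rewrite pE mean_posterior.
have postq f : bmfun D f ->
    \int[prior]_(F in D) (f F * q F) = \int[post y]_(F in D) f F.
  by move=> bf; rewrite qE mean_posterior.
have bX2 : bmfun D (fun F => X F ^+ 2) by exact: bmfunX.
have px : \int[prior]_(F in D) (X F * p F) = column_pairing i x (ewa x).
  by rewrite (postp _ bX); exact: mean_column_pairing.
have qy : \int[prior]_(F in D) (X F * q F) = column_pairing i x (ewa y).
  by rewrite (postq _ bX); exact: mean_column_pairing.
have hx : \int[prior]_(F in D) (X F ^+ 2 * p F)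
    - (\int[prior]_(F in D) (X F * p F)) ^+ 2 <= K%:R * B ^+ 2 * column_variance i x.
  by rewrite (postp _ bX2) (postp _ bX); exact: variance_column_pairing_le.
have hy : \int[prior]_(F in D) (X F ^+ 2 * q F)
    - (\int[prior]_(F in D) (X F * q F)) ^+ 2 <= K%:R * B ^+ 2 * column_variance i y.
  by rewrite (postq _ bX2) (postq _ bX); exact: variance_column_pairing_le.
apply: (@le_trans _ _ (\int[prior]_(F in D) (X F * p F)
                       - \int[prior]_(F in D) (X F * q F))).
  by rewrite px qy; exact: lexx.
apply: le_trans (tilted_mean_diff mD priorD bX bp bq q0 c0 t0 pq small p1 q1) _.
rewrite -[in leRHS]mulrA; apply: ler_wpM2l.
  by apply: mulr_ge0 => //; lra.
by rewrite mulrDr; exact: lerD hx hy.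
Qed.

(** * Averaging over a bounded noise law invariant under sign flips *)

Section noise.
Variable mu : probability M R.
Hypothesis mu_bounded : forall i : 'I_n,
  mu [set x | K%:R * B ^+ 2 < enorm (col i x) ^+ 2] = 0%E.
Hypothesis mu_symmetric : forall s : 'I_n -> R, (forall i, s i = 1 \/ s i = -1) ->
  forall A, measurable A -> mu (scale_cols s @^-1` A) = mu A.

(** Means over the noise are restricted to this set of full measure, because the column bound holds
    only almost surely. *)
Definition bounded_noise : set M :=
  [set x | forall i : 'I_n, enorm (col i x) ^+ 2 <= K%:R * B ^+ 2].
Local Notation O := bounded_noise.

Let measurable_enorm_col i :
  measurable_fun [set: M] (fun x : M => enorm (col i x) ^+ 2).
Proof.
under eq_fun do rewrite enorm_sqr; apply: measurable_sum => k.
apply: measurable_funX; under eq_fun do rewrite mxE.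
exact: measurable_mx_coord.
Qed.

Lemma measurable_bounded_noise : measurable O.
Proof.
rewrite (_ : O = \bigcap_(i in [set: 'I_n])
    [set x : M | enorm (col i x) ^+ 2 <= K%:R * B ^+ 2]); last first.
  by apply/seteqP; split => x Ox i => [_|]; exact: Ox.
apply: fin_bigcap_measurable => // i _.
rewrite (_ : [set _ | _] =
    (fun x : M => enorm (col i x) ^+ 2) @^-1` `]-oo, K%:R * B ^+ 2]%classic).
  by rewrite -[X in measurable X]setTI; exact: measurable_enorm_col.
by apply/seteqP; split => x /=; rewrite in_itv.
Qed.

Local Notation mO := measurable_bounded_noise.

Lemma bounded_noise_full : mu O = 1%E.
Proof.
have [N [mN N0 ON]] : {ae mu, forall x, O x}.
  apply: (@filter_forall M 'I_n
    (fun i => [set x : M | enorm (col i x) ^+ 2 <= K%:R * B ^+ 2])) => i.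
  exists [set x | K%:R * B ^+ 2 < enorm (col i x) ^+ 2]; split => //.
    rewrite (_ : [set _ | _] =
      (fun x : M => enorm (col i x) ^+ 2) @^-1` `]K%:R * B ^+ 2, +oo[%classic).
      by rewrite -[X in measurable X]setTI; exact: measurable_enorm_col.
    by apply/seteqP; split => x /=; rewrite in_itv/= andbT.
  by move=> x /= /negP; rewrite ltNge.
have OC : mu (~` O) = 0%E.
  by apply: subset_measure0 N0 => //; exact: measurableC mO.
by rewrite -(setCK O) probability_setC ?[X in (_ - X)%E]OC ?sube0//; exact: measurableC mO.
Qed.

Lemma bmfun_noise k i : bmfun O (fun x : M => x k i).
Proof.
apply: (@bmfun_coord _ _ _ _ 0 (K%:R * B ^+ 2)) => [|F j OF]; first exact: mO.
by rewrite -raddfB/= subr0; exact: OF.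
Qed.

Lemma flip_preimage i : scale_cols (flip i) @^-1` O = O.
Proof.
have h (x : M) j : enorm (col j (scale_cols (flip i) x)) ^+ 2 = enorm (col j x) ^+ 2.
  rewrite !enorm_sqr; apply: eq_bigr => k _; rewrite !mxE /flip.
  by case: ifP => _; rewrite ?mulN1r ?mul1r ?sqrrN.
by apply/seteqP; split => x Ox j; have := Ox j; rewrite h.
Qed.

(** Change of variables along the flip: it preserves the law by symmetry, and the set of bounded
    noise because column norms ignore signs. *)
Lemma mean_flip i (f : M -> R) : measurable_fun setT f -> bmfun O f ->
  \int[mu]_(x in O) f (scale_cols (flip i) x) = \int[mu]_(x in O) f x.
Proof.
move=> mf bf; congr fine.
have mphi := @measurable_scale_cols R K n (flip i).
rewrite -[in LHS](flip_preimage i).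
rewrite -(@integral_pushforward _ _ _ _ _ _ mphi mu O (EFin \o f)).
- by apply: eq_measure_integral => A mA _; exact: mu_symmetric (flip_sign i) A mA.
- exact/measurable_EFinP.
- rewrite flip_preimage.
  apply: (@bmfun_integrable _ _ _ _ mO mu (fun x => f (scale_cols (flip i) x))).
  split; first by apply: measurable_funTS; exact: measurableT_comp.
  have [_ [c fc]] := bf; exists c => x; rewrite -(flip_preimage i); exact: fc.
- exact: mO.
Qed.

Lemma bmfun_flip i (f : M -> R) : measurable_fun setT f -> bmfun O f ->
  bmfun O (fun x => f (scale_cols (flip i) x)).
Proof.
move=> mf [_ [c fc]]; split.
  apply: measurable_funTS; apply: measurableT_comp => //.
  exact: measurable_scale_cols.
by exists c => x; rewrite -(flip_preimage i); exact: fc.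
Qed.

Lemma mean_noise_eq0 k i : \int[mu]_(x in O) x k i = 0.
Proof.
have bx := bmfun_noise k i.
have := @mean_flip i (fun x => x k i) (measurable_mx_coord _ _) bx.
rewrite (@eq_Rintegral _ _ _ _ _ (fun x : M => -1 * x k i)); last first.
  by move=> x _; rewrite scale_flip eqxx mulN1r.
by rewrite (meanZ mO)//; lra.
Qed.

(** Flipping column [i] negates it in the pairing, so S(x) + S(flipped x) is the difference bounded
    for fixed noise. Since the flip preserves means, integration doubles both sides. *)
Lemma mean_column_pairing_ewa_le i :
  \int[mu]_(x in O) column_pairing i x (ewa x) <=
  3 / 2 * (tau * n%:R)^-1 * (K%:R * B ^+ 2) *
  \int[mu]_(x in O) column_variance i x.
Proof.
have mO' := mO; have bV := bmfun_column_variance O i.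
have mV : measurable_fun setT (column_variance i).
  by have [] := bmfun_column_variance setT i.
pose S x := column_pairing i x (ewa x).
have bS : bmfun O S.
  by apply: bmfun_sum => k; apply: bmfunM; [exact: bmfun_noise|exact: bmfun_ewa].
have mS : measurable_fun setT S.
  apply: measurable_sum => k; apply: measurable_funM; last exact: measurable_ewa.
  exact: measurable_mx_coord.
have bSf := bmfun_flip i mS bS; have bVf := bmfun_flip i mV bV.
have bSS := bmfunD bS bSf; have bVV := bmfunD bV bVf.
set c := _ * _ * (_ * _).
have : \int[mu]_(x in O) (S x + S (scale_cols (flip i) x)) <=
    \int[mu]_(x in O) (c * (column_variance i x +
                           column_variance i (scale_cols (flip i) x))).
  apply: (mean_le mO' mu bSS (bmfunZ c bVV)) => x Ox.
  apply: le_trans (column_pairing_flip_le (Ox i)).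
  rewrite le_eqVlt; apply/orP; left; apply/eqP; congr (_ + _).
  by rewrite -sumrN; apply: eq_bigr => k _; rewrite scale_flip eqxx mulNr.
rewrite (meanZ mO' mu c bVV) (meanD mO' mu bS bSf) (meanD mO' mu bV bVf).
rewrite [X in _ + X <= _](mean_flip i mS bS) [X in _ <= _ * (_ + X)](mean_flip i mV bV).
change (\int[mu]_(x in O) S x + \int[mu]_(x in O) S x <=
  c * (\int[mu]_(x in O) column_variance i x + \int[mu]_(x in O) column_variance i x) ->
  \int[mu]_(x in O) S x <= c * \int[mu]_(x in O) column_variance i x).
move: (\int[mu]_(x in O) S x) (\int[mu]_(x in O) column_variance i x) => s v.
by rewrite mulrDr; lra.
Qed.

(** In the averaged deterministic bound, the pairing with the mean of [p] vanishes because the noise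
    is centred. The column bounds sum to a multiple of the spread, which is moved to the left. *)
Lemma mean_ell_ewa_le (p : probability M R) (kl : R) : p D = 1%E ->
  KL p prior = kl%:E ->
  \int[mu]_(x in O) ell (ewa x) Fstar
  + (1 - 3 * (tau * n%:R)^-1 * (K%:R * B ^+ 2)) *
      \int[mu]_(x in O) posterior_spread x <=
  \int[p]_(F in D) ell F Fstar + 2 * tau * kl.
Proof.
move=> pD klE; have mO' := mO; have muO := bounded_noise_full.
pose Mp : M := \matrix_(k, i) \int[p]_(F in D) F k i.
set C := _ + 2 * tau * kl.
have bl := bmfun_ell_ewa O; have bV := bmfun_posterior_spread O.
have bP : bmfun O (fun x => pairing x (ewa x)).
  apply: bmfun_sum => i; apply: bmfun_sum => k.
  by apply: bmfunM; [exact: bmfun_noise|exact: bmfun_ewa].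
have bQ : bmfun O (fun x => pairing x Mp).
  apply: bmfun_sum => i; apply: bmfun_sum => k.
  by apply: bmfunM; [exact: bmfun_noise|exact: bmfun_cst].
have h : \int[mu]_(x in O) (ell (ewa x) Fstar + posterior_spread x) <=
    \int[mu]_(x in O) (C + 2 / n%:R * (pairing x (ewa x) - pairing x Mp)).
  apply: mean_le => //.
  - exact: bmfunD.
  - by apply: bmfunD => //; apply: bmfunZ; exact: bmfunB.
  by move=> x _; exact: ell_ewa_le.
have bPQ := bmfunB bP bQ.
rewrite (meanD mO' mu bl bV) (meanD mO' mu (bmfun_cst O C) (bmfunZ _ bPQ)) in h.
rewrite (meanZ mO' mu _ bPQ) (meanB mO' mu bP bQ) (mean_cst mO' muO) in h.
have Q0 : \int[mu]_(x in O) pairing x Mp = 0.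
  rewrite mean_sum//; last first.
    by move=> i; apply: bmfun_sum => k; apply: bmfunM => //; exact: bmfun_noise.
  rewrite big1// => i _; rewrite mean_sum//; last first.
    by move=> k; apply: bmfunM => //; exact: bmfun_noise.
  rewrite big1// => k _.
  rewrite (@eq_Rintegral _ _ _ _ _ (fun x : M => Mp k i * x k i)) => [|x _]; last first.
    by rewrite mulrC.
  by rewrite meanZ ?mean_noise_eq0 ?mulr0//; exact: bmfun_noise.
have P0 : \int[mu]_(x in O) pairing x (ewa x) <=
    3 / 2 * (tau * n%:R)^-1 * (K%:R * B ^+ 2) *
    (n%:R * \int[mu]_(x in O) posterior_spread x).
  rewrite mean_sum//; last first.
    move=> i; apply: bmfun_sum => k.
    by apply: bmfunM; [exact: bmfun_noise|exact: bmfun_ewa].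
  rewrite (@eq_Rintegral _ _ _ _ _ (fun x : M =>
    n%:R^-1 * \sum_i column_variance i x)); last first.
    by move=> x _; exact: posterior_spreadE.
  have bW := bmfun_column_variance O.
  rewrite meanZ//; last exact: bmfun_sum.
  rewrite mulVKf ?gt_eqF// mean_sum// mulr_sumr; apply: ler_sum => i _.
  exact: mean_column_pairing_ewa_le.
rewrite Q0 subr0 in h.
have n2 : 0 <= 2 / n%:R :> R by rewrite divr_ge0// ltW.
have {P0} := ler_wpM2l n2 P0.
set v := \int[mu]_(x in O) posterior_spread x in h *.
have -> : 2 / n%:R * (3 / 2 * (tau * n%:R)^-1 * (K%:R * B ^+ 2) * (n%:R * v)) =
    3 * (tau * n%:R)^-1 * (K%:R * B ^+ 2) * v.
  by field; rewrite pnatr_eq0 -lt0n n_gt0 gt_eqF.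
lra.
Qed.

End noise.

End aggregate.

(** * From expectations on the sample space to integrals over the noise law *)

Section law.
Context (R : realType) (n K : nat) (n_gt0 : (0 < n)%N).
Context d (Omega : measurableType d) (P : probability Omega R).
Local Notation M := 'M[R]_(K, n).
Variables (Fstar : M) (xi : {RV P >-> M}) (D : set M) (mD : measurable D).
Variables (prior : probability M R) (prior_D : prior D = 1%E).
Variables (B L : R) (B_gt0 : 0 < B) (L_gt0 : 0 < L).
Variable (xi_bounded : forall i : 'I_n,
  P [set w | K%:R * B ^+ 2 < enorm (col i (xi w)) ^+ 2] = 0%E).
Variable (D_bounded : forall F F' : M, D F -> D F' -> forall i : 'I_n,
  enorm (col i F - col i F') ^+ 2 <= K%:R * L ^+ 2).
Variable (xi_symmetric : forall s : 'I_n -> R, (forall i, s i = 1 \/ s i = -1) ->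
  same_law P (fun w => scale_cols s (xi w)) xi).
Variables (tau : R) (tau0 : 0 < tau).
Hypothesis tauL : n%:R^-1 * (K%:R * B) * (2 * L) <= tau.

Local Notation mu := (distribution P xi : probability M R).
Local Notation O := (bounded_noise B : set M).
Local Notation fhat := (ewa D prior tau Fstar).
Local Notation spread := (posterior_spread D prior tau Fstar).

Let ge0_integral_noise (f : M -> R) :
  bmfun setT f -> (forall x, 0 <= f x) ->
  (\int[P]_w (f (xi w))%:E)%E = (\int[mu]_(x in O) f x)%:E.
Proof.
move=> bf f0; have mO := @measurable_bounded_noise R n K B.
have [mf _] := bf.
have mfE : measurable_fun setT (EFin \o f) by exact/measurable_EFinP.
rewrite -(@ge0_integral_distribution _ _ _ _ _ P xi (EFin \o f))//.
rewrite (@ge0_integral_full _ _ _ mu O)//; last exact: bounded_noise_full.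
rewrite bmfun_integralE//; have [_ [c fc]] := bf.
by split; [exact: measurable_funTS|exists c => x _; exact: fc].
Qed.

Lemma expectation_ell_ewa : 'E_P[fun w => ell (fhat (xi w)) Fstar]%E =
  (\int[mu]_(x in O) ell (fhat x) Fstar)%:E.
Proof.
rewrite unlock; apply: (ge0_integral_noise (bmfun_ell_ewa mD prior_D D_bounded tau0 Fstar setT)).
by move=> x; exact: ell_ge0.
Qed.

Lemma expectation_spread :
  (\int[P]_w \int[posterior prior tau (Fstar + xi w)]_(F in D)
     (ell (fhat (xi w)) F)%:E)%E = (\int[mu]_(x in O) spread x)%:E.
Proof.
rewrite (eq_integral (fun w => (spread (xi w))%:E)); last first.
  move=> w _; rewrite bmfun_integralE//; apply: bmfun_ell => k i.
    exact: bmfun_cst.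
  exact: (bmfun_prior_coord mD prior_D D_bounded k i).
apply: (ge0_integral_noise
  (bmfun_posterior_spread mD prior_D D_bounded tau0 Fstar setT)) => x.
by apply: Rintegral_ge0 => F _; exact: ell_ge0.
Qed.

(** The parameter [e] is the share of the spread retained on the left: 0 for the first bound, 1/2
    for the second. *)
Lemma oracle_bound_ge (e : R) :
  e <= 1 - 3 * (tau * n%:R)^-1 * (K%:R * B ^+ 2) ->
  ((\int[mu]_(x in O) ell (fhat x) Fstar + e * \int[mu]_(x in O) spread x)%:E
   <= oracle_bound D prior tau Fstar)%E.
Proof.
move=> he; apply/ereal_infP => _ [p pD <-].
have t2 : 0 < 2 * tau by rewrite mulr_gt0.
have bl : bmfun D (fun F => ell F Fstar).
  by apply: bmfun_ell => k i; [exact: (bmfun_prior_coord mD prior_D D_bounded k i)|exact: bmfun_cst].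
rewrite bmfun_integralE//.
(* A finite lower bound excludes the value -oo of [KL]; the value +oo makes the right side
   infinite. *)
have := mean_sub_ln_mean_expR_le_KL mD pD
  (bmfunZ (- (2 * tau)^-1) bl) (bmfun_gibbs_weight D tau0 Fstar)
  (normalization_gt0 mD prior_D tau0 Fstar).
case klE : (KL p prior) => [kl| |] // _; last first.
  by rewrite gt0_muley ?lte_fin// addey// leey.
rewrite -EFinM -EFinD lee_fin.
have sym : forall s : 'I_n -> R, (forall i, s i = 1 \/ s i = -1) ->
    forall A, measurable A -> mu (scale_cols s @^-1` A) = mu A.
  by move=> s hs A mA; exact: xi_symmetric.
apply: le_trans (mean_ell_ewa_le n_gt0 mD prior_D B_gt0 L_gt0 D_bounded tau0
  Fstar tauL (mu := mu) xi_bounded sym pD klE).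
rewrite lerD2l ler_wpM2r//.
by apply: Rintegral_ge0 => x _; apply: Rintegral_ge0 => F _; exact: ell_ge0.
Qed.

End law.

Theorem theorem1 (R : realType) (n K : nat) (n_gt0 : (0 < n)%N) (K_gt0 : (0 < K)%N)
    (d : measure_display) (Omega : measurableType d) (P : probability Omega R)
    (Fstar : 'M[R]_(K, n)) (xi : {RV P >-> 'M[R]_(K, n)})
    (D : set 'M[R]_(K, n)) (D_measurable : measurable D)
    (prior : probability 'M[R]_(K, n) R) (prior_D : probability_on D prior)
    (B L : R) (B_gt0 : 0 < B) (L_gt0 : 0 < L)
    (xi_bounded : forall i : 'I_n,
       P [set w | K%:R * B ^+ 2 < enorm (col i (xi w)) ^+ 2] = 0%E)
    (D_bounded : forall F F' : 'M[R]_(K, n), D F -> D F' -> forall i : 'I_n,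
       enorm (col i F - col i F') ^+ 2 <= K%:R * L ^+ 2)
    (xi_symmetric : forall s : 'I_n -> R, (forall i, s i = 1 \/ s i = -1) ->
       same_law P (fun w => scale_cols s (xi w)) xi) :
  let Y (w : Omega) : 'M[R]_(K, n) := Fstar + xi w in
  (forall tau : R, 0 < tau ->
     n%:R^-1 * (K%:R * B) * Num.max (2 * L) (3 * B) <= tau ->
     let Fhat w := EWA prior tau (Y w) D in
     ('E_P[fun w => ell (Fhat w) Fstar] <= oracle_bound D prior tau Fstar)%E) /\
  (forall tau : R, 0 < tau ->
     n%:R^-1 * (K%:R * B) * Num.max (2 * L) (6 * B) <= tau ->
     let Fhat w := EWA prior tau (Y w) D in
     ('E_P[fun w => ell (Fhat w) Fstar] <=
      oracle_bound D prior tau Fstar -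
      (2^-1)%:E * \int[P]_w \int[posterior prior tau (Y w)]_(F in D)
                              (ell (Fhat w) F)%:E)%E).
Proof.
have n0 : 0 < n%:R :> R by rewrite ltr0n.
have KB0 : 0 <= n%:R^-1 * (K%:R * B) by rewrite !mulr_ge0 ?invr_ge0// ltW.
have maxl (c tau : R) : n%:R^-1 * (K%:R * B) * Num.max (2 * L) (c * B) <= tau ->
    n%:R^-1 * (K%:R * B) * (2 * L) <= tau.
  by apply: le_trans; rewrite ler_wpM2l// le_max lexx.
(* The second entry of the maximum gives c K B^2 / n <= tau; rescaling by 3 / (c tau) bounds the
   coefficient by 1 for c = 3 and by 1/2 for c = 6. *)
have maxr (c tau : R) : 0 < c -> 0 < tau ->
    n%:R^-1 * (K%:R * B) * Num.max (2 * L) (c * B) <= tau ->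
    3 * (tau * n%:R)^-1 * (K%:R * B ^+ 2) <= 3 / c.
  move=> c0 tau0 h.
  have {h} : n%:R^-1 * (K%:R * B) * (c * B) <= tau.
    by apply: le_trans h; rewrite ler_wpM2l// le_max lexx orbT.
  rewrite -(@ler_pM2l _ (3 / (c * tau))) ?divr_gt0 ?mulr_gt0//.
  congr (_ <= _); field; rewrite ?(gt_eqF n0) ?(gt_eqF c0) ?(gt_eqF tau0)//.
split=> tau tau0 tauB.
  have tauL := maxl _ _ tauB.
  have [tauV] : 0 <= 1 - 3 * (tau * n%:R)^-1 * (K%:R * B ^+ 2).
    by have := maxr 3 tau (ltr0Sn _ _) tau0 tauB; rewrite divff ?pnatr_eq0//; lra.
  change ('E_P[fun w => ell (ewa D prior tau Fstar (xi w)) Fstar] <=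
    oracle_bound D prior tau Fstar)%E.
  rewrite (expectation_ell_ewa Fstar D_measurable prior_D xi_bounded D_bounded tau0).
  have := oracle_bound_ge n_gt0 Fstar D_measurable prior_D B_gt0 L_gt0 xi_bounded
    D_bounded xi_symmetric tau0 tauL tauV.
  by rewrite mul0r addr0.
have tauL := maxl _ _ tauB.
have tauV : 2^-1 <= 1 - 3 * (tau * n%:R)^-1 * (K%:R * B ^+ 2).
  have := maxr 6 tau (ltr0Sn _ _) tau0 tauB; lra.
change ('E_P[fun w => ell (ewa D prior tau Fstar (xi w)) Fstar] <=
  oracle_bound D prior tau Fstar - (2^-1)%:E *
  \int[P]_w \int[posterior prior tau (Fstar + xi w)]_(F in D)
    (ell (ewa D prior tau Fstar (xi w)) F)%:E)%E.
rewrite (expectation_ell_ewa Fstar D_measurable prior_D xi_bounded D_bounded tau0).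
rewrite (expectation_spread Fstar D_measurable prior_D xi_bounded D_bounded tau0).
(* The expected spread is now a real number, so the subtracted term can cross the inequality. *)
rewrite leeBrDr// -EFinM -EFinD.
exact: (oracle_bound_ge n_gt0 Fstar D_measurable prior_D B_gt0 L_gt0 xi_bounded
  D_bounded xi_symmetric tau0 tauL tauV).
Qed.
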